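(* For $\ell>0$ let $\Omega_\ell=(0,\pi)\times(-\ell,\ell)$ and let $\lambda_1(\Omega_\ell)$ be the smallest eigenvalue of the problem \[ \begin{cases} \Delta^2 u=-\lambda \Delta u, & \text{in }\Omega_\ell,\\ u=0, & \text{on }\partial\Omega_\ell,\\ u_y=0, & \text{on }(0,\pi)\times\{-\ell,\ell\},\\ u_{xx}=0, & \text{on }\{0,\pi\}\times(-\ell,\ell). \end{cases} \] Then there exists a sequence $\ell_k\to0$ such that, for each $k$, there exists an eigenfunction associated with $\lambda_1(\Omega_{\ell_k})$ having exactly $k$ nodal domains.
   Context: A nodal domain of a function $u$ on $\Omega_\ell$ is a connected component of $\{(x,y)\in\Omega_\ell: u(x,y)\neq0\}$. *)

(* Defs.v *)
From Stdlib Require Import Reals Lra.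
Open Scope R_scope.

Definition is_dx (f g : R -> R -> R) : Prop :=
  forall x y, derivable_pt_lim (fun t => f t y) x (g x y).
Definition is_dy (f g : R -> R -> R) : Prop :=
  forall x y, derivable_pt_lim (fun t => f x t) y (g x y).

Definition cont2 (f : R -> R -> R) : Prop :=
  forall x y eps, 0 < eps -> exists delta, 0 < delta /\
    forall x' y', (x' - x) ^ 2 + (y' - y) ^ 2 < delta ^ 2 ->
      Rabs (f x' y' - f x y) < eps.

Definition C4_with (u : R -> R -> R) (D : nat -> nat -> R -> R -> R) : Prop :=
  D 0%nat 0%nat = u /\
  (forall i j, (i + j < 4)%nat -> is_dx (D i j) (D (S i) j)) /\
  (forall i j, (i + j < 4)%nat -> is_dy (D i j) (D i (S j))) /\
  (forall i j, (i + j <= 4)%nat -> cont2 (D i j)).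

Definition in_Omega (l x y : R) : Prop := 0 < x < PI /\ - l < y < l.
Definition in_closure (l x y : R) : Prop := 0 <= x <= PI /\ - l <= y <= l.
Definition on_boundary (l x y : R) : Prop := in_closure l x y /\ ~ in_Omega l x y.

Definition eigenfunction (l lam : R) (u : R -> R -> R) : Prop :=
  exists D : nat -> nat -> R -> R -> R,
    C4_with u D /\
    (exists x y, in_Omega l x y /\ u x y <> 0) /\
    (forall x y, in_Omega l x y ->
       D 4%nat 0%nat x y + 2 * D 2%nat 2%nat x y + D 0%nat 4%nat x y
       = - lam * (D 2%nat 0%nat x y + D 0%nat 2%nat x y)) /\
    (forall x y, on_boundary l x y -> u x y = 0) /\
    (forall x, 0 < x < PI -> D 0%nat 1%nat x (- l) = 0 /\ D 0%nat 1%nat x l = 0) /\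
    (forall y, - l < y < l -> D 2%nat 0%nat 0 y = 0 /\ D 2%nat 0%nat PI y = 0).

Definition eigenvalue (l lam : R) : Prop := exists u, eigenfunction l lam u.

Definition is_lambda1 (l lam : R) : Prop :=
  eigenvalue l lam /\ forall mu, eigenvalue l mu -> lam <= mu.

Definition open2 (U : R -> R -> Prop) : Prop :=
  forall x y, U x y -> exists e, 0 < e /\
    forall x' y', (x' - x) ^ 2 + (y' - y) ^ 2 < e ^ 2 -> U x' y'.

Definition connected2 (C : R -> R -> Prop) : Prop :=
  ~ exists U V : R -> R -> Prop,
      open2 U /\ open2 V /\
      (forall x y, C x y -> U x y \/ V x y) /\
      (forall x y, C x y -> U x y -> V x y -> False) /\
      (exists x y, C x y /\ U x y) /\ (exists x y, C x y /\ V x y).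

Definition same_component (S : R -> R -> Prop) (p q : R * R) : Prop :=
  exists C : R -> R -> Prop,
    (forall x y, C x y -> S x y) /\ connected2 C /\
    C (fst p) (snd p) /\ C (fst q) (snd q).

Definition num_components (S : R -> R -> Prop) (k : nat) : Prop :=
  exists c : nat -> R * R,
    (forall i, (i < k)%nat -> S (fst (c i)) (snd (c i))) /\
    (forall i j, (i < k)%nat -> (j < k)%nat -> i <> j -> ~ same_component S (c i) (c j)) /\
    (forall x y, S x y -> exists i, (i < k)%nat /\ same_component S (x, y) (c i)).

Definition num_nodal_domains (l : R) (u : R -> R -> R) (k : nat) : Prop :=
  num_components (fun x y => in_Omega l x y /\ u x y <> 0) k.

(* Main.v *)
Require Import Defs.
From Stdlib Require Import Reals ZArith Lra Lia Psatz.
From Coquelicot Require Import Coquelicot.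
Open Scope R_scope.

(* Separating variables as [phi y * sin (m x)], the eigenvalue equation becomes
   [(d^2 - m^2) (d^2 - m^2 + lam) phi = 0] with [phi = phi' = 0] at [-l] and [l].  With [s = m l]
   and [lam l^2 = s^2 + t^2], the even modes are given by [dispersion s t = 0], and the odd ones
   only occur for [t > PI].  Let [(s, t)] be a zero of [dispersion], [s > 0], closest to the
   origin in the quadrant; it satisfies [s^2 + t^2 < PI^2].  Then [lam l^2 >= s^2 + t^2] for every
   eigenvalue, whatever the width [l], because some sine coefficient in [x] of the eigenfunction
   is a nonzero one-dimensional mode.  For [l = s / k] equality holds with [m = k], and since
   the profile [phi] is positive the eigenfunction [phi y * sin (k x)] has exactly [k] nodal
   domains. *)

(** * The dispersion function and its first zero *)

(** No variational characterisation of the first eigenvalue enters: every real [mu] that admits an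
    eigenfunction is bounded directly. Clamping puts four end conditions on a fourth-order equation.
    Instead of a 4x4 determinant, the proof uses [psi = phi'' - m^2 phi], which solves a
    second-order equation, and reads the end conditions as orthogonality of [psi] to [cosh (m y)]
    and [sinh (m y)]. Parity splits this into two scalar integrals, and a nonzero mode requires one
    of them to vanish. The bound by PI is what has to be secured. On the axis [s = 0] the dispersion
    function is [t * sin t], whose first positive zero is PI. An explicit point inside the disc of
    radius PI with a negative value forces the closest zero off that axis, and inside this disc the
    integral for odd modes stays positive. Searching over all real [s > 0], not only the multiples
    of a given [l], is why a single estimate serves every width. *)

Lemma is_derive_incr (f df : R -> R) (a b : R) :
  a < b -> (forall x, a <= x <= b -> is_derive f x (df x)) ->
  (forall x, a < x < b -> 0 < df x) -> f a < f b.
Proof.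
  intros Hab Hd Hp.
  destruct (MVT_cor2 f df a b Hab) as [c [Hc Hc']].
  { intros c Hc. apply is_derive_Reals, Hd, Hc. }
  specialize (Hp c Hc'). nra.
Qed.

Lemma cosh_pos (x : R) : 0 < cosh x.
Proof. unfold cosh. generalize (exp_pos x) (exp_pos (- x)). lra. Qed.

Lemma sinh_pos (x : R) : 0 < x -> 0 < sinh x.
Proof.
  intros Hx. unfold sinh. generalize (exp_increasing (- x) x). lra.
Qed.

Lemma cosh_opp (x : R) : cosh (- x) = cosh x.
Proof. unfold cosh. rewrite Ropp_involutive. field. Qed.

Lemma sinh_opp (x : R) : sinh (- x) = - sinh x.
Proof. unfold sinh. rewrite Ropp_involutive. field. Qed.

(** Equals [s^2 + t^2] times the integral of [cos (t y) * cosh (s y)] over [0, 1], the pairing that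
    must vanish for an even clamped mode to exist. *)
Definition dispersion (s t : R) : R := t * sin t * cosh s + s * cos t * sinh s.

Lemma dispersion_pos_small (s t : R) :
  0 <= s -> 0 <= t <= PI / 2 -> 0 < s ^ 2 + t ^ 2 -> 0 < dispersion s t.
Proof.
  intros Hs Ht Hst. unfold dispersion.
  pose proof (cosh_pos s) as Hc.
  assert (Hcos : 0 <= cos t) by (apply cos_ge_0; lra).
  assert (Hsh : 0 <= sinh s).
  { destruct (Req_dec s 0) as [->|]. rewrite sinh_0; lra.
    left; apply sinh_pos; lra. }
  assert (H2 : 0 <= s * cos t * sinh s).
  { apply Rmult_le_pos; [apply Rmult_le_pos|]; lra. }
  destruct (Req_dec t 0) as [->|Hn].
  - rewrite sin_0, cos_0. assert (0 < s) by nra.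
    pose proof (sinh_pos s H). nra.
  - assert (0 < sin t) by (apply sin_gt_0; lra).
    assert (0 < t * sin t * cosh s).
    { apply Rmult_lt_0_compat; [apply Rmult_lt_0_compat|]; lra. }
    lra.
Qed.

(** With [a = 18/100] the claim becomes [(PI - a) * sin a * cosh 1 < cos a * sinh 1]. The value [a]
    is large enough to put the point inside the disc of radius PI, which needs
    [2 * a * PI > 1 + a^2], and small enough for the inequality to survive the crude bounds
    [sin a < a] and [PI <= 4]. *)
Lemma dispersion_neg_point : dispersion 1 (PI - 18 / 100) < 0.
Proof.
  unfold dispersion.
  pose proof PI2_3_2 as HPl. pose proof PI_4 as HPu.
  rewrite sin_minus, cos_minus, sin_PI, cos_PI.
  assert (Hs : sin (18/100) < 18/100) by (apply sin_lt_x; lra).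
  assert (Hs0 : 0 < sin (18/100)) by (apply sin_gt_0; lra).
  assert (Hc : cos (18/100) > 983/1000).
  { pose proof (is_derive_incr (fun x => cos x + x * x / 2) (fun x => x - sin x) 0 (18/100))
      as H. cbv beta in H. rewrite cos_0 in H.
    cut (1 + 0 * 0 / 2 < cos (18/100) + (18/100)*(18/100)/2). lra.
    apply H. lra. intros x _; auto_derive; auto; field.
    intros x Hx. pose proof (sin_lt_x x). lra. }
  (* The bound [tanh 1 > 0.705] amounts to [exp 2 > 1.705 / 0.295], about 5.78. The margin up to 5.9
     allows squaring [exp (1/4) > 5/4] three times with rounding. *)
  assert (He : exp 2 > 5.9).
  { assert (Hq : 1 + 1/4 < exp (1/4)) by (apply exp_ineq1; lra).
    replace 2 with (1/4 + 1/4 + (1/4 + 1/4) + (1/4 + 1/4 + (1/4 + 1/4))) by field.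
    rewrite !exp_plus. set (e := exp (1/4)) in *.
    assert (1.56 < e * e) by nra.
    assert (2.433 < e * e * (e * e)) by nra.
    nra. }
  assert (Hth : 0.705 * cosh 1 < sinh 1).
  { unfold cosh, sinh. replace 2 with (1 + 1) in He at 1 by ring.
    rewrite exp_plus in He.
    assert (exp 1 * exp (-1) = 1)
      by (rewrite <- exp_plus; replace (1 + - 1) with 0 by ring; apply exp_0).
    pose proof (exp_pos 1). pose proof (exp_pos (-1)).
    replace (-(1)) with (-1) by ring.
    nra. }
  pose proof (cosh_pos 1).
  set (a := sin (18/100)) in *. set (c := cos (18/100)) in *.
  assert (H1 : (PI - 18/100) * a <= 3.82 * (18/100)) by nra.
  assert (H2 : (PI - 18/100) * a * cosh 1 <= 3.82 * (18/100) * cosh 1)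
    by (apply Rmult_le_compat_r; lra).
  assert (H3 : 983/1000 * sinh 1 <= c * sinh 1) by (apply Rmult_le_compat_r; lra).
  lra.
Qed.

Lemma continuity_pt_derivable (f : R -> R) (x : R) : ex_derive f x -> continuity_pt f x.
Proof.
  intros H. apply continuity_pt_filterlim, (@ex_derive_continuous R_AbsRing R_NormedModule), H.
Qed.

Lemma dispersion_continuous (a b : R -> R -> R) (x y : R) :
  continuity_2d_pt a x y -> continuity_2d_pt b x y ->
  continuity_2d_pt (fun x y => dispersion (a x y) (b x y)) x y.
Proof.
  intros Ha Hb. unfold dispersion.
  assert (Hs : continuity_2d_pt (fun x y => sin (b x y)) x y)
    by (apply (continuity_1d_2d_pt_comp sin); [apply continuity_sin|assumption]).
  assert (Hc : continuity_2d_pt (fun x y => cos (b x y)) x y)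
    by (apply (continuity_1d_2d_pt_comp cos); [apply continuity_cos|assumption]).
  assert (Hch : continuity_2d_pt (fun x y => cosh (a x y)) x y)
    by (apply (continuity_1d_2d_pt_comp cosh); [|assumption];
        apply continuity_pt_derivable; auto_derive; auto).
  assert (Hsh : continuity_2d_pt (fun x y => sinh (a x y)) x y)
    by (apply (continuity_1d_2d_pt_comp sinh); [|assumption];
        apply continuity_pt_derivable; auto_derive; auto).
  apply (continuity_2d_pt_plus (fun x y => b x y * sin (b x y) * cosh (a x y))
           (fun x y => a x y * cos (b x y) * sinh (a x y))).
  - apply (continuity_2d_pt_mult (fun x y => b x y * sin (b x y))); [|assumption].
    apply continuity_2d_pt_mult; assumption.
  - apply (continuity_2d_pt_mult (fun x y => a x y * cos (b x y))); [|assumption].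
    apply continuity_2d_pt_mult; assumption.
Qed.

Lemma dispersion_polar_continuous (th r : R) :
  continuity_2d_pt (fun th r => dispersion (r * sin th) (r * cos th)) th r.
Proof.
  apply dispersion_continuous.
  - apply (continuity_2d_pt_mult (fun th r => r) (fun th r => sin th)).
    apply continuity_2d_pt_id2.
    apply (continuity_1d_2d_pt_comp sin (fun th r => th)).
    apply continuity_sin. apply continuity_2d_pt_id1.
  - apply (continuity_2d_pt_mult (fun th r => r) (fun th r => cos th)).
    apply continuity_2d_pt_id2.
    apply (continuity_1d_2d_pt_comp cos (fun th r => th)).
    apply continuity_cos. apply continuity_2d_pt_id1.
Qed.

Lemma polar_quadrant (s t : R) : 0 < s -> 0 <= t ->
  exists th, 0 <= th <= PI / 2 /\
    s = sqrt (s ^ 2 + t ^ 2) * sin th /\ t = sqrt (s ^ 2 + t ^ 2) * cos th.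
Proof.
  intros Hs Ht.
  set (r := sqrt (s ^ 2 + t ^ 2)).
  assert (Hr : r * r = s ^ 2 + t ^ 2) by (apply sqrt_sqrt; nra).
  assert (Hr0 : 0 < r) by (apply sqrt_lt_R0; nra).
  assert (Hb : 0 <= t / r <= 1).
  { split. apply Rmult_le_pos; [lra|]. left; apply Rinv_0_lt_compat; lra.
    apply (Rmult_le_reg_r r); [lra|]. replace (t / r * r) with t by (field; lra). nra. }
  exists (acos (t / r)).
  assert (Hac : cos (acos (t / r)) = t / r) by (apply cos_acos; lra).
  pose proof (acos_bound (t / r)) as Hbd.
  assert (Hq : 0 <= acos (t / r) <= PI / 2).
  { split; [lra|]. destruct (Rle_lt_dec (acos (t/r)) (PI/2)); [lra|].
    assert (cos (acos (t/r)) < 0) by (apply cos_lt_0; lra). lra. }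
  split; [exact Hq|]. rewrite Hac. split; [|field; lra].
  rewrite sin_acos by lra.
  replace (1 - (t / r)²) with ((s / r) ^ 2).
  - rewrite <- Rsqr_pow2. rewrite sqrt_Rsqr. field; lra.
    apply Rmult_le_pos; [lra|]. left; apply Rinv_0_lt_compat; lra.
  - unfold Rsqr. apply (Rmult_eq_reg_r (r * r)); [|nra].
    replace ((s / r) ^ 2 * (r * r)) with (s ^ 2) by (field; lra).
    replace ((1 - t / r * (t / r)) * (r * r)) with (r * r - t ^ 2) by (field; lra). lra.
Qed.

(** In polar coordinates, [r] is the supremum of the radii up to which the function is positive on
    every closed quarter arc. The minimum over the arc of radius [r] is then zero: a negative value
    would persist at smaller radii on the same ray, and a positive minimum would, by uniform
    continuity in the angle, carry positivity beyond [r]. *)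
Lemma first_dispersion_zero :
  exists s t, 0 < s /\ 0 < t /\ s ^ 2 + t ^ 2 < PI ^ 2 /\ dispersion s t = 0 /\
    forall s' t', 0 < s' -> 0 <= t' -> s' ^ 2 + t' ^ 2 < s ^ 2 + t ^ 2 ->
      0 < dispersion s' t'.
Proof.
  set (g := fun th r => dispersion (r * sin th) (r * cos th)).
  set (E := fun r => 0 < r /\ forall th rho, 0 <= th <= PI / 2 -> 0 < rho <= r -> 0 < g th rho).
  pose proof PI2_3_2 as HPl. pose proof PI_4 as HPu.
  destruct (polar_quadrant 1 (PI - 18/100)) as [th1 [Hth1 [Hs1 Ht1]]]; [lra|lra|].
  set (r1 := sqrt (1 ^ 2 + (PI - 18/100) ^ 2)) in *.
  assert (Hr1 : r1 * r1 = 1 ^ 2 + (PI - 18/100) ^ 2) by (apply sqrt_sqrt; nra).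
  assert (Hr10 : 0 <= r1) by apply sqrt_pos.
  assert (Hr1P : r1 < PI) by nra.
  assert (Hg1 : g th1 r1 < 0).
  { unfold g. rewrite <- Hs1, <- Ht1. apply dispersion_neg_point. }
  (* Radius 1 is below PI / 2, so the whole arc lies where both terms of [dispersion] are
     nonnegative. *)
  assert (HE1 : E 1).
  { split; [lra|]. intros th rho Hth Hrho. unfold g.
    assert (0 <= sin th) by (apply sin_ge_0; lra).
    assert (0 <= cos th) by (apply cos_ge_0; lra).
    pose proof (COS_bound th).
    pose proof (sin2_cos2 th) as Hsc. unfold Rsqr in Hsc.
    apply dispersion_pos_small.
    - nra.
    - split; nra.
    - replace ((rho * sin th) ^ 2 + (rho * cos th) ^ 2) with (rho * rho) by nra. nra. }
  assert (Hbd : forall r, E r -> r <= r1).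
  { intros r [_ Hr]. destruct (Rle_lt_dec r r1); [assumption|].
    assert (0 < g th1 r1).
    { apply Hr. exact Hth1. split; [|lra]. nra. }
    lra. }
  destruct (completeness E) as [r [Hub Hlub]].
  { exists r1. exact Hbd. }
  { exists 1. exact HE1. }
  assert (Hr_1 : 1 <= r) by (apply Hub, HE1).
  assert (Hr_r1 : r <= r1) by (apply Hlub; exact Hbd).
  assert (Hbelow : forall th rho, 0 <= th <= PI / 2 -> 0 < rho < r -> 0 < g th rho).
  { intros th rho Hth Hrho.
    destruct (Rlt_le_dec 0 (g th rho)) as [|Hle]; [assumption|].
    exfalso. assert (r <= rho); [|lra].
    apply Hlub. intros x [Hx0 Hx]. destruct (Rle_lt_dec x rho); [assumption|].
    specialize (Hx th rho Hth). lra. }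
  destruct (continuity_ab_min (fun th => g th r) 0 (PI / 2)) as [th [Hmin Hth]].
  { lra. }
  { intros c _. unfold g, dispersion. apply continuity_pt_derivable. auto_derive. auto. }
  assert (Hge : ~ g th r < 0).
  { intros Hneg.
    destruct (dispersion_polar_continuous th r (mkposreal (- g th r) ltac:(lra)))
      as [d Hd]. simpl in Hd. pose proof (cond_pos d) as Hd0.
    assert (Hm : exists rho, 0 < rho < r /\ Rabs (rho - r) < d).
    { exists (r - Rmin (d / 2) (r / 2)).
      pose proof (Rmin_l (d/2) (r/2)). pose proof (Rmin_r (d/2) (r/2)).
      assert (0 < Rmin (d/2) (r/2)) by (apply Rmin_pos; lra).
      split; [lra|]. rewrite Rabs_left; lra. }
    destruct Hm as [rho [Hrho Hrd]].
    specialize (Hbelow th rho Hth Hrho).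
    specialize (Hd th rho).
    assert (Rabs (g th rho - g th r) < - g th r).
    { apply Hd. rewrite Rminus_diag, Rabs_R0. lra. exact Hrd. }
    apply Rabs_def2 in H. lra. }
  assert (Hle : ~ 0 < g th r).
  { intros Hpos.
    destruct (uniform_continuity_2d_1d g 0 (PI/2) r
      (fun x _ => dispersion_polar_continuous x r) (mkposreal (g th r) Hpos)) as [d Hd].
    simpl in Hd. pose proof (cond_pos d) as Hd0.
    assert (r + d <= r); [|lra].
    apply Hub. split; [lra|]. intros th' rho Hth' Hrho.
    destruct (Rlt_le_dec rho r) as [Hlt|Hgt].
    - apply Hbelow; [assumption|lra].
    - specialize (Hd th' r th' rho Hth' ltac:(lra) Hth' ltac:(lra)).
      rewrite Rminus_diag, Rabs_R0 in Hd. specialize (Hd Hd0).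
      apply Rabs_def2 in Hd. specialize (Hmin th' Hth'). lra. }
  assert (H0 : g th r = 0) by lra.
  pose proof (sin2_cos2 th) as Hsc. unfold Rsqr in Hsc.
  assert (Hnorm : (r * sin th) ^ 2 + (r * cos th) ^ 2 = r * r) by nra.
  assert (Hsin : 0 <= sin th) by (apply sin_ge_0; lra).
  assert (Hcos : 0 <= cos th) by (apply cos_ge_0; lra).
  pose proof (COS_bound th).
  (* The arcs include both axes for compactness, so these are excluded afterwards. On [s = 0] the
     value is [r * sin r], positive because [r < PI]. *)
  assert (Hsin' : sin th <> 0).
  { intros Hz. unfold g, dispersion in H0. rewrite Hz in H0, Hsc.
    replace (cos th) with 1 in H0 by nra.
    rewrite Rmult_0_r, Rmult_1_r, cosh_0 in H0.
    assert (0 < sin r) by (apply sin_gt_0; lra). nra. }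
  assert (Hcos' : cos th <> 0).
  { intros Hz. unfold g in H0.
    assert (0 < dispersion (r * sin th) (r * cos th)); [|lra].
    apply dispersion_pos_small; rewrite ?Hz; nra. }
  exists (r * sin th), (r * cos th).
  split; [nra|]. split; [nra|]. split; [rewrite Hnorm; nra|]. split; [exact H0|].
  intros s' t' Hs' Ht' Hlt. rewrite Hnorm in Hlt.
  destruct (polar_quadrant s' t' Hs' Ht') as [th' [Hth' [Es Et]]].
  set (rho := sqrt (s' ^ 2 + t' ^ 2)) in *.
  assert (Hrho : rho * rho = s' ^ 2 + t' ^ 2) by (apply sqrt_sqrt; nra).
  assert (Hrho0 : 0 <= rho) by apply sqrt_pos.
  specialize (Hbelow th' rho Hth'). unfold g in Hbelow. rewrite <- Es, <- Et in Hbelow.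
  apply Hbelow. split; nra.
Qed.

(** * Clamped one-dimensional modes *)

Ltac rewrite_derive :=
  repeat match goal with
  | |- context [Derive ?f ?x] => erewrite (is_derive_unique f x) by eauto
  end.

Lemma is_derive_zero_const (f df : R -> R) (a b : R) :
  (forall x, is_derive f x (df x)) -> (forall x, a < x < b -> df x = 0) ->
  forall x y, a <= x <= b -> a <= y <= b -> f x = f y.
Proof.
  intros Hd H0.
  assert (H : forall x y, a <= x <= b -> a <= y <= b -> x < y -> f x = f y).
  { intros x y Hx Hy Hxy.
    destruct (MVT_cor2 f df x y Hxy) as [c [Hc Hc']].
    { intros c _. apply is_derive_Reals, Hd. }
    rewrite H0 in Hc; lra. }
  intros x y Hx Hy. destruct (Rtotal_order x y) as [|[->|]]; auto.
  symmetry; auto.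
Qed.

(** The even and odd solutions of [f'' = q f] normalised at 0, with their derivatives. Abstracting
    them lets one argument serve the hyperbolic, affine and trigonometric cases. *)
Record fundamental (q : R) (C C1 S S1 : R -> R) : Prop := {
  fund_C : forall y, is_derive C y (C1 y);
  fund_C1 : forall y, is_derive C1 y (q * C y);
  fund_S : forall y, is_derive S y (S1 y);
  fund_S1 : forall y, is_derive S1 y (q * S y);
  fund_C_0 : C 0 = 1;
  fund_C1_0 : C1 0 = 0;
  fund_S_0 : S 0 = 0;
  fund_S1_0 : S1 0 = 1;
  fund_C_even : forall y, C (- y) = C y;
  fund_S_odd : forall y, S (- y) = - S y }.

Lemma fundamental_cosh (k : R) : k <> 0 ->
  fundamental (k ^ 2) (fun y => cosh (k * y)) (fun y => k * sinh (k * y))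
    (fun y => sinh (k * y) / k) (fun y => cosh (k * y)).
Proof.
  intros Hk. split; intros; rewrite ?Rmult_0_r, ?cosh_0, ?sinh_0;
    try (auto_derive; auto; field; auto).
  - reflexivity.
  - field; auto.
  - field; auto.
  - reflexivity.
  - rewrite <- cosh_opp. f_equal. ring.
  - replace (k * - y) with (- (k * y)) by ring. rewrite sinh_opp. field; auto.
Qed.

Lemma fundamental_cos (w : R) : w <> 0 ->
  fundamental (- w ^ 2) (fun y => cos (w * y)) (fun y => - w * sin (w * y))
    (fun y => sin (w * y) / w) (fun y => cos (w * y)).
Proof.
  intros Hk. split; intros; rewrite ?Rmult_0_r, ?cos_0, ?sin_0;
    try (auto_derive; auto; field; auto).
  - reflexivity.
  - field; auto.
  - field; auto.
  - reflexivity.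
  - rewrite <- cos_neg. f_equal. ring.
  - replace (w * - y) with (- (w * y)) by ring. rewrite sin_neg. field; auto.
Qed.

Lemma fundamental_0 : fundamental 0 (fun _ => 1) (fun _ => 0) (fun y => y) (fun _ => 1).
Proof.
  split; intros; try (auto_derive; auto; ring); ring.
Qed.

(** The Wronskians of [f] with [C] and with [S] are constant, and that of [C] and [S] is 1; solving
    the resulting linear system gives [f]. The equation is required only inside the interval, since
    the mean value theorem only samples interior points. *)
Lemma fundamental_solution (q l : R) (C C1 S S1 f f1 f2 : R -> R) :
  0 < l -> fundamental q C C1 S S1 ->
  (forall y, is_derive f y (f1 y)) -> (forall y, is_derive f1 y (f2 y)) ->
  (forall y, - l < y < l -> f2 y = q * f y) ->
  forall y, - l <= y <= l -> f y = f 0 * C y + f1 0 * S y.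
Proof.
  intros Hl HF Hf Hf1 Hq y Hy.
  destruct HF as [DC DC1 DS DS1 C0 C10 S0 S10 _ _].
  assert (HC : f y * C1 y - f1 y * C y = f 0 * C1 0 - f1 0 * C 0).
  { apply (is_derive_zero_const (fun y => f y * C1 y - f1 y * C y)
      (fun y => f y * (q * C y) - f2 y * C y) (- l) l); [| |lra|lra].
    - intros x. auto_derive.
      { repeat split; eexists; eauto. }
      rewrite_derive. ring.
    - intros x Hx. rewrite Hq by assumption. ring. }
  assert (HS : f y * S1 y - f1 y * S y = f 0 * S1 0 - f1 0 * S 0).
  { apply (is_derive_zero_const (fun y => f y * S1 y - f1 y * S y)
      (fun y => f y * (q * S y) - f2 y * S y) (- l) l); [| |lra|lra].
    - intros x. auto_derive.
      { repeat split; eexists; eauto. }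
      rewrite_derive. ring.
    - intros x Hx. rewrite Hq by assumption. ring. }
  assert (HW : C y * S1 y - C1 y * S y = 1).
  { replace 1 with (C 0 * S1 0 - C1 0 * S 0) by (rewrite C0, C10, S0, S10; ring).
    apply (is_derive_zero_const (fun y => C y * S1 y - C1 y * S y)
      (fun y => 0) (- l) l); [|auto|lra|lra].
    intros x. auto_derive.
    { repeat split; eexists; eauto. }
    rewrite_derive. ring. }
  rewrite C0, C10 in HC. rewrite S0, S10 in HS.
  transitivity (f y * (C y * S1 y - C1 y * S y)). { rewrite HW; ring. }
  transitivity (C y * (f y * S1 y - f1 y * S y) - S y * (f y * C1 y - f1 y * C y)).
  { ring. }
  rewrite HC, HS. ring.
Qed.

(* The integral of [g] over [0, l] is nonzero, expressed through primitives. *)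
Definition nonzero_mean (g : R -> R) (l : R) : Prop :=
  forall K : R -> R, (forall y, 0 <= y <= l -> is_derive K y (g y)) -> K 0 <> K l.

Lemma nonzero_mean_pos (g : R -> R) (l : R) :
  0 < l -> (forall y, 0 < y < l -> 0 < g y) -> nonzero_mean g l.
Proof.
  intros Hl Hg K HK. pose proof (is_derive_incr K g 0 l Hl HK Hg). lra.
Qed.

Lemma nonzero_mean_primitive (g F : R -> R) (l : R) :
  0 < l -> (forall y, is_derive F y (g y)) -> F 0 <> F l -> nonzero_mean g l.
Proof.
  intros Hl HF Hne K HK.
  destruct (MVT_cor2 (fun y => K y - F y) (fun y => g y - g y) 0 l Hl) as [c [Hc _]].
  { intros c Hc. apply derivable_pt_lim_minus; apply is_derive_Reals; auto. }
  cbv beta in Hc. lra.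
Qed.

(* With [h'' = m^2 h], the function [a1 h - a0 h'] is a primitive of [psi h] vanishing at
   both ends; its odd part kills the half of [psi] whose parity is opposite to that of [h]. *)
Lemma clamped_orthogonal (m l alpha : R) (a0 a1 a2 g h h1 : R -> R) :
  0 < l ->
  (forall y, is_derive a0 y (a1 y)) -> (forall y, is_derive a1 y (a2 y)) ->
  a0 (- l) = 0 -> a0 l = 0 -> a1 (- l) = 0 -> a1 l = 0 ->
  (forall y, is_derive h y (h1 y)) -> (forall y, is_derive h1 y (m ^ 2 * h y)) ->
  (forall y, 0 <= y <= l ->
     (a2 y - m ^ 2 * a0 y) * h y + (a2 (- y) - m ^ 2 * a0 (- y)) * h (- y)
     = 2 * alpha * g y) ->
  nonzero_mean g l -> alpha = 0.
Proof.
  intros Hl D0 D1 B1 B2 B3 B4 Dh Dh1 Hg Hnz.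
  destruct (Req_dec alpha 0) as [|Ha]; [assumption|exfalso].
  set (Q := fun y => a1 y * h y - a0 y * h1 y).
  apply (Hnz (fun y => (Q y - Q (- y)) / (2 * alpha))).
  - intros y Hy.
    apply (is_derive_ext (fun y => / (2 * alpha) * (Q y - Q (- y)))).
    { intros z; simpl; field; auto. }
    replace (g y) with (/ (2 * alpha) * (2 * alpha * g y)) by (field; auto).
    rewrite <- Hg by assumption. unfold Q.
    auto_derive.
    { repeat split; eexists; eauto. }
    rewrite_derive.
    field. auto.
  - unfold Q. rewrite B1, B2, B3, B4, Ropp_0. field. auto.
Qed.

Lemma is_derive_cosh_scal (m y : R) : is_derive (fun y => cosh (m * y)) y (m * sinh (m * y)).
Proof. auto_derive; auto. ring. Qed.

Lemma is_derive_sinh_scal (m y : R) :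
  is_derive (fun y => m * sinh (m * y)) y (m ^ 2 * cosh (m * y)).
Proof. auto_derive; auto. ring. Qed.

(** The function [psi = a2 - m^2 a0] is a combination [alpha C + beta S]. Orthogonality to
    [cosh (m y)] kills [alpha], orthogonality to [sinh (m y)] kills [beta], and then [a0'' = m^2 a0]
    with zero Cauchy data at [l]. *)
Lemma clamped_trivial (m l q : R) (C C1 S S1 a0 a1 a2 a3 a4 : R -> R) :
  0 < m -> 0 < l -> fundamental q C C1 S S1 ->
  nonzero_mean (fun y => C y * cosh (m * y)) l ->
  nonzero_mean (fun y => S y * sinh (m * y)) l ->
  (forall y, is_derive a0 y (a1 y)) -> (forall y, is_derive a1 y (a2 y)) ->
  (forall y, is_derive a2 y (a3 y)) -> (forall y, is_derive a3 y (a4 y)) ->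
  a0 (- l) = 0 -> a0 l = 0 -> a1 (- l) = 0 -> a1 l = 0 ->
  (forall y, - l < y < l -> a4 y - m ^ 2 * a2 y = q * (a2 y - m ^ 2 * a0 y)) ->
  forall y, - l < y < l -> a0 y = 0.
Proof.
  intros Hm Hl HF NC NS D0 D1 D2 D3 B1 B2 B3 B4 HE y Hy.
  set (psi := fun y => a2 y - m ^ 2 * a0 y).
  assert (Hpsi : forall y, - l <= y <= l ->
    psi y = psi 0 * C y + (a3 0 - m ^ 2 * a1 0) * S y).
  { apply (fundamental_solution q l C C1 S S1 psi (fun y => a3 y - m ^ 2 * a1 y)
      (fun y => a4 y - m ^ 2 * a2 y)); try assumption.
    - intros x. unfold psi. auto_derive.
      { repeat split; eexists; eauto. }
      rewrite_derive. ring.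
    - intros x. auto_derive.
      { repeat split; eexists; eauto. }
      rewrite_derive. ring. }
  set (alpha := psi 0) in *. set (beta := a3 0 - m ^ 2 * a1 0) in *.
  assert (Ha : alpha = 0).
  { apply (clamped_orthogonal m l alpha a0 a1 a2 (fun y => C y * cosh (m * y))
      (fun y => cosh (m * y)) (fun y => m * sinh (m * y))); try assumption.
    - intros; apply is_derive_cosh_scal.
    - intros; apply is_derive_sinh_scal.
    - intros x Hx. fold (psi x) (psi (- x)).
      rewrite !Hpsi, (fund_C_even _ _ _ _ _ HF), (fund_S_odd _ _ _ _ _ HF) by lra.
      replace (m * - x) with (- (m * x)) by ring. rewrite cosh_opp. ring. }
  assert (Hb : beta = 0).
  { apply (clamped_orthogonal m l beta a0 a1 a2 (fun y => S y * sinh (m * y))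
      (fun y => sinh (m * y)) (fun y => m * cosh (m * y))); try assumption.
    - intros x; auto_derive; auto; ring.
    - intros x; auto_derive; auto; ring.
    - intros x Hx. fold (psi x) (psi (- x)).
      rewrite !Hpsi, (fund_C_even _ _ _ _ _ HF), (fund_S_odd _ _ _ _ _ HF) by lra.
      replace (m * - x) with (- (m * x)) by ring. rewrite sinh_opp. ring. }
  assert (Hpsi0 : forall y, - l < y < l -> a2 y = m ^ 2 * a0 y).
  { intros x Hx. specialize (Hpsi x). rewrite Ha, Hb in Hpsi. unfold psi in Hpsi. lra. }
  (* Factor [d^2 - m^2] as [(d + k) (d - k)] and integrate with the factor [exp (k y)]. The two
     roots [k = m] and [k = - m] together give [a0 y = 0]. *)
  assert (H1 : forall k, k ^ 2 = m ^ 2 -> a1 y - k * a0 y = 0).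
  { intros k Hk.
    assert (He : exp (k * y) * (a1 y - k * a0 y) = exp (k * l) * (a1 l - k * a0 l)).
    { apply (is_derive_zero_const (fun y => exp (k * y) * (a1 y - k * a0 y))
       (fun y => exp (k * y) * (a2 y - k ^ 2 * a0 y)) (- l) l); [| |lra|lra].
      - intros x. auto_derive.
        { repeat split; eexists; eauto. }
        rewrite_derive. ring.
      - intros x Hx. rewrite Hpsi0, Hk by assumption. ring. }
    rewrite B2, B4 in He. pose proof (exp_pos (k * y)). nra. }
  pose proof (H1 m eq_refl). pose proof (H1 (- m) ltac:(ring)). nra.
Qed.

(** The sign of [m^2 - mu] selects the fundamental pair. If [mu <= m^2] both integrands are
    positive. Otherwise, with [w^2 = mu - m^2], the point [(m l, w l)] has squared norm [mu * l^2],
    so it lies in the region where [dispersion] is positive, which settles the even integral;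
    [w l < PI] makes the odd integrand positive. *)
Lemma clamped_mode_trivial (s t m l mu : R) (a0 a1 a2 a3 a4 : R -> R) :
  s ^ 2 + t ^ 2 < PI ^ 2 ->
  (forall s' t', 0 < s' -> 0 <= t' -> s' ^ 2 + t' ^ 2 < s ^ 2 + t ^ 2 ->
      0 < dispersion s' t') ->
  0 < m -> 0 < l -> mu * l ^ 2 < s ^ 2 + t ^ 2 ->
  (forall y, is_derive a0 y (a1 y)) -> (forall y, is_derive a1 y (a2 y)) ->
  (forall y, is_derive a2 y (a3 y)) -> (forall y, is_derive a3 y (a4 y)) ->
  a0 (- l) = 0 -> a0 l = 0 -> a1 (- l) = 0 -> a1 l = 0 ->
  (forall y, - l < y < l ->
     a4 y - 2 * m ^ 2 * a2 y + m ^ 4 * a0 y = - mu * (a2 y - m ^ 2 * a0 y)) ->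
  forall y, - l < y < l -> a0 y = 0.
Proof.
  intros HPI Hdisp Hm Hl Hmu D0 D1 D2 D3 B1 B2 B3 B4 HE.
  assert (HE' : forall y, - l < y < l ->
    a4 y - m ^ 2 * a2 y = (m ^ 2 - mu) * (a2 y - m ^ 2 * a0 y)).
  { intros y Hy. specialize (HE y Hy). lra. }
  destruct (Rtotal_order mu (m ^ 2)) as [Hlt|[Heq|Hgt]].
  - set (k := sqrt (m ^ 2 - mu)).
    assert (Hk : 0 < k) by (apply sqrt_lt_R0; lra).
    assert (Hk2 : m ^ 2 - mu = k ^ 2) by (unfold k; rewrite pow2_sqrt; lra).
    rewrite Hk2 in HE'.
    apply (clamped_trivial m l (k ^ 2) _ _ _ _ a0 a1 a2 a3 a4 Hm Hl
             (fundamental_cosh k ltac:(lra))); try assumption.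
    + apply nonzero_mean_pos; [assumption|]. intros y Hy.
      apply Rmult_lt_0_compat; apply cosh_pos.
    + apply nonzero_mean_pos; [assumption|]. intros y Hy.
      apply Rmult_lt_0_compat; [apply Rdiv_lt_0_compat|];
        try apply sinh_pos; try assumption; apply Rmult_lt_0_compat; lra.
  - replace (m ^ 2 - mu) with 0 in HE' by lra.
    apply (clamped_trivial m l 0 _ _ _ _ a0 a1 a2 a3 a4 Hm Hl fundamental_0);
      try assumption.
    + apply nonzero_mean_pos; [assumption|]. intros y Hy.
      rewrite Rmult_1_l. apply cosh_pos.
    + apply nonzero_mean_pos; [assumption|]. intros y Hy.
      apply Rmult_lt_0_compat; [lra|].
      apply sinh_pos; apply Rmult_lt_0_compat; lra.
  - set (w := sqrt (mu - m ^ 2)).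
    assert (Hw : 0 < w) by (apply sqrt_lt_R0; lra).
    assert (Hw2 : mu - m ^ 2 = w ^ 2) by (unfold w; rewrite pow2_sqrt; lra).
    replace (m ^ 2 - mu) with (- w ^ 2) in HE' by lra.
    assert (Hr : (m * l) ^ 2 + (w * l) ^ 2 < s ^ 2 + t ^ 2).
    { replace ((m * l) ^ 2 + (w * l) ^ 2) with (mu * l ^ 2); [assumption|].
      replace mu with (w ^ 2 + m ^ 2) by lra. ring. }
    assert (Hml : 0 < m * l) by (apply Rmult_lt_0_compat; lra).
    assert (Hwl : 0 < w * l) by (apply Rmult_lt_0_compat; lra).
    pose proof PI_RGT_0.
    assert (HwP : w * l < PI) by nra.
    apply (clamped_trivial m l (- w ^ 2) _ _ _ _ a0 a1 a2 a3 a4 Hm Hl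
             (fundamental_cos w ltac:(lra))); try assumption.
    + assert (Hden : 0 < w ^ 2 + m ^ 2) by nra.
      (* An explicit primitive of [cos (w y) * cosh (m y)]; its value at [l] is a positive multiple
         of [dispersion (m * l) (w * l)]. *)
      apply (nonzero_mean_primitive _ (fun y =>
        (w * sin (w * y) * cosh (m * y) + m * cos (w * y) * sinh (m * y)) / (w ^ 2 + m ^ 2)));
        [assumption| |].
      * intros y. auto_derive; auto. field. nra.
      * rewrite !Rmult_0_r, sin_0, sinh_0.
        specialize (Hdisp (m * l) (w * l) Hml ltac:(lra) Hr).
        replace ((w * sin (w * l) * cosh (m * l) + m * cos (w * l) * sinh (m * l))
                 / (w ^ 2 + m ^ 2))
          with (dispersion (m * l) (w * l) * / l * / (w ^ 2 + m ^ 2))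
          by (unfold dispersion; field; lra).
        assert (0 < dispersion (m * l) (w * l) * / l * / (w ^ 2 + m ^ 2)).
        { apply Rmult_lt_0_compat; [apply Rmult_lt_0_compat|];
            try apply Rinv_0_lt_compat; assumption. }
        lra.
    + apply nonzero_mean_pos; [assumption|]. intros y Hy.
      apply Rmult_lt_0_compat; [apply Rdiv_lt_0_compat|]; [|assumption|].
      * apply sin_gt_0; nra.
      * apply sinh_pos; nra.
Qed.

(** * Completeness of the sine system on [0, PI] *)

Lemma ex_RInt_continuous_R (f : R -> R) (a b : R) :
  (forall x, continuous f x) -> ex_RInt f a b.
Proof. intros H. apply (@ex_RInt_continuous R_CompleteNormedModule). auto. Qed.

Lemma continuous_derivable (f : R -> R) (x : R) : ex_derive f x -> continuous f x.
Proof. apply (@ex_derive_continuous R_AbsRing R_NormedModule). Qed.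

Lemma continuous_mul (f g : R -> R) (x : R) :
  continuous f x -> continuous g x -> continuous (fun x => f x * g x) x.
Proof. apply (continuous_mult f g). Qed.

Lemma continuous_lin (a b : R) (f g : R -> R) (x : R) :
  continuous f x -> continuous g x -> continuous (fun x => a * f x + b * g x) x.
Proof.
  intros Hf Hg. apply (continuous_plus (fun x => a * f x) (fun x => b * g x));
    apply continuous_mul; auto; apply continuous_const.
Qed.

Definition sine_coeff (m : nat) (f : R -> R) : R :=
  RInt (fun x => f x * sin (INR m * x)) 0 PI.

Lemma ex_RInt_mul_sin (m : nat) (f : R -> R) :
  (forall x, continuous f x) -> ex_RInt (fun x => f x * sin (INR m * x)) 0 PI.
Proof.
  intros Hc. apply ex_RInt_continuous_R. intros x.
  apply (continuous_mul f (fun x => sin (INR m * x))); [apply Hc|].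
  apply continuous_derivable. auto_derive. auto.
Qed.

Lemma sine_coeff_lin (m : nat) (a b : R) (f g : R -> R) :
  (forall x, continuous f x) -> (forall x, continuous g x) ->
  sine_coeff m (fun x => a * f x + b * g x) = a * sine_coeff m f + b * sine_coeff m g.
Proof.
  intros Hcf Hcg. unfold sine_coeff.
  rewrite (RInt_ext _ (fun x => a * (f x * sin (INR m * x)) + b * (g x * sin (INR m * x))))
    by (intros; simpl; ring).
  assert (Hf := ex_RInt_mul_sin m f Hcf). assert (Hg := ex_RInt_mul_sin m g Hcg).
  rewrite (RInt_plus (fun x => a * (f x * sin (INR m * x))) (fun x => b * (g x * sin (INR m * x)))).
  - rewrite (RInt_scal (fun x => f x * sin (INR m * x))) by auto.
    rewrite (RInt_scal (fun x => g x * sin (INR m * x))) by auto.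
    reflexivity.
  - apply (ex_RInt_scal (fun x => f x * sin (INR m * x))); auto.
  - apply (ex_RInt_scal (fun x => g x * sin (INR m * x))); auto.
Qed.

Lemma sine_coeff_ext (m : nat) (f g : R -> R) :
  (forall x, 0 < x < PI -> f x = g x) -> sine_coeff m f = sine_coeff m g.
Proof.
  intros He. apply RInt_ext. pose proof PI_RGT_0.
  rewrite Rmin_left, Rmax_right by lra. intros x Hx. rewrite He; auto.
Qed.

Lemma sine_coeff_zero (m : nat) (f : R -> R) :
  (forall x, 0 < x < PI -> f x = 0) -> sine_coeff m f = 0.
Proof.
  intros Hf. rewrite (sine_coeff_ext m f (fun _ => 0) Hf). unfold sine_coeff.
  rewrite (RInt_ext _ (fun _ => 0)).
  - rewrite RInt_const. unfold scal; simpl; unfold mult; simpl. ring.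
  - intros x _. simpl. ring.
Qed.

Definition sine_orthogonal (f : R -> R) : Prop := forall m : nat, sine_coeff m f = 0.

Lemma sine_coeff_0 (f : R -> R) : sine_coeff 0 f = 0.
Proof.
  unfold sine_coeff. rewrite (RInt_ext _ (fun _ => 0)).
  - rewrite RInt_const. unfold scal; simpl; unfold mult; simpl. ring.
  - intros x _. simpl. rewrite Rmult_0_l, sin_0. ring.
Qed.

(** Product to sum: [2 cos x sin (n x) = sin ((n+1) x) + sin ((n-1) x)]. By iteration, orthogonality
    survives multiplication by any polynomial in [cos x]. *)
Lemma sine_orthogonal_mul_cos (f : R -> R) :
  (forall x, continuous f x) -> sine_orthogonal f ->
  sine_orthogonal (fun x => f x * cos x).
Proof.
  intros Hc Hf m.
  destruct m as [|m]; [apply sine_coeff_0|]. unfold sine_coeff.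
  rewrite (RInt_ext _ (fun x => (1 / 2) * (f x * sin (INR (S (S m)) * x) + f x * sin (INR m * x)))).
  - assert (Hex := fun n => ex_RInt_mul_sin n f Hc).
    rewrite (RInt_scal (fun x => f x * sin (INR (S (S m)) * x) + f x * sin (INR m * x))).
    + rewrite (RInt_plus (fun x => f x * sin (INR (S (S m)) * x)) (fun x => f x * sin (INR m * x)))
        by apply Hex.
      fold (sine_coeff (S (S m)) f) (sine_coeff m f). rewrite !Hf.
      unfold scal, plus; simpl; unfold mult; simpl. ring.
    + apply (ex_RInt_plus (fun x => f x * sin (INR (S (S m)) * x))); apply Hex.
  - intros x _.
    replace (INR (S (S m)) * x) with (INR (S m) * x + x) by (rewrite !S_INR; ring).
    replace (INR m * x) with (INR (S m) * x - x) by (rewrite !S_INR; ring).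
    rewrite sin_plus, sin_minus. simpl. field.
Qed.

Lemma sine_orthogonal_lin (a b : R) (f g : R -> R) :
  (forall x, continuous f x) -> (forall x, continuous g x) ->
  sine_orthogonal f -> sine_orthogonal g ->
  sine_orthogonal (fun x => a * f x + b * g x).
Proof.
  intros Hcf Hcg Hf Hg m. rewrite sine_coeff_lin, Hf, Hg by assumption. ring.
Qed.

(* Peaked at [x0] on [0, PI]; its powers play the role of an approximate identity. *)
Definition bump (x0 x : R) : R := 1 - (cos x - cos x0) ^ 2 / 4.

Lemma continuous_bump_pow (x0 : R) (n : nat) (x : R) :
  continuous (fun x => bump x0 x ^ n) x.
Proof. apply continuous_derivable. unfold bump. auto_derive. auto. Qed.

Lemma sine_orthogonal_ext (f g : R -> R) :
  (forall x, f x = g x) -> sine_orthogonal f -> sine_orthogonal g.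
Proof.
  intros He Hf m. rewrite <- (Hf m). apply sine_coeff_ext. auto.
Qed.

Lemma sine_orthogonal_bump (x0 : R) (f : R -> R) (n : nat) :
  (forall x, continuous f x) -> sine_orthogonal f ->
  sine_orthogonal (fun x => f x * bump x0 x ^ n).
Proof.
  intros Hc Hf. induction n as [|n IH].
  - apply (sine_orthogonal_ext f); [|exact Hf]. intros; simpl; ring.
  - set (h := fun x => f x * bump x0 x ^ n) in *.
    assert (Hch : forall x, continuous h x).
    { intros x. apply continuous_mul. apply Hc. apply continuous_bump_pow. }
    assert (Hcos : forall x, continuous cos x).
    { intros x. apply continuous_derivable. auto_derive. auto. }
    assert (Hh1 := sine_orthogonal_mul_cos h Hch IH).
    assert (Hch1 : forall x, continuous (fun x => h x * cos x) x).
    { intros x. apply continuous_mul; auto. }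
    assert (Hh2 := sine_orthogonal_mul_cos _ Hch1 Hh1).
    (* The expansion of [bump] as a quadratic polynomial in [cos x], multiplied by [h]. *)
    apply (sine_orthogonal_ext (fun x => 1 *
      ((1 - cos x0 ^ 2 / 4) * h x + (cos x0 / 2) * (h x * cos x))
      + (- 1 / 4) * (h x * cos x * cos x))).
    + intros x. unfold h, bump. simpl. field.
    + apply (sine_orthogonal_lin 1 (-1/4)
        (fun x => (1 - cos x0 ^ 2 / 4) * h x + (cos x0 / 2) * (h x * cos x))
        (fun x => h x * cos x * cos x)).
      * intros x. apply continuous_lin; auto.
      * intros x. apply continuous_mul; auto.
      * apply sine_orthogonal_lin; auto.
      * exact Hh2.
Qed.

(** The divisor 4 in [bump] is the square of the largest possible gap between two cosines. *)
Lemma bump_range (x0 x : R) : 0 <= bump x0 x <= 1.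
Proof.
  unfold bump. pose proof (COS_bound x). pose proof (COS_bound x0).
  assert (0 <= (2 - (cos x - cos x0)) * (2 + (cos x - cos x0)))
    by (apply Rmult_le_pos; lra).
  pose proof (pow2_ge_0 (cos x - cos x0)).
  split; lra.
Qed.

(** Strict monotonicity of the cosine on [0, PI] keeps [cos x] at distance at least [e] from
    [cos x0]. *)
Lemma bump_far (x0 d : R) : 0 < d -> 0 < x0 - d -> x0 + d < PI ->
  exists rho, 0 <= rho < 1 /\
    forall x, 0 <= x <= PI -> (x <= x0 - d \/ x0 + d <= x) -> bump x0 x <= rho.
Proof.
  intros Hd H1 H2.
  set (e := Rmin (cos (x0 - d) - cos x0) (cos x0 - cos (x0 + d))).
  assert (He1 : e <= cos (x0 - d) - cos x0) by apply Rmin_l.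
  assert (He2 : e <= cos x0 - cos (x0 + d)) by apply Rmin_r.
  assert (He : 0 < e).
  { apply Rmin_pos.
    - assert (cos x0 < cos (x0 - d)) by (apply cos_decreasing_1; lra). lra.
    - assert (cos (x0 + d) < cos x0) by (apply cos_decreasing_1; lra). lra. }
  exists (1 - e ^ 2 / 4).
  pose proof (COS_bound x0). pose proof (COS_bound (x0 - d)).
  split.
  { assert (0 <= (2 - e) * (2 + e)) by (apply Rmult_le_pos; lra).
    assert (0 < e ^ 2) by (apply pow_lt; lra). split; lra. }
  intros x Hx [Hl|Hr]; unfold bump.
  - assert (cos (x0 - d) <= cos x) by (apply cos_decr_1; lra).
    assert (e ^ 2 <= (cos x - cos x0) ^ 2) by (apply pow_incr; lra). lra.
  - assert (cos x <= cos (x0 + d)) by (apply cos_decr_1; lra).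
    assert (e ^ 2 <= (- (cos x - cos x0)) ^ 2) by (apply pow_incr; lra). lra.
Qed.

Lemma continuous_ball (f : R -> R) (x eps : R) : continuous f x -> 0 < eps ->
  exists d, 0 < d /\ forall y, Rabs (y - x) <= d -> Rabs (f y - f x) < eps.
Proof.
  intros Hc He.
  apply continuity_pt_filterlim in Hc.
  destruct (Hc eps He) as [d [Hd H]].
  exists (d / 2). split; [lra|]. intros y Hy.
  destruct (Req_dec x y) as [->|Hne].
  - rewrite Rminus_diag, Rabs_R0. exact He.
  - apply H. split; [split; [exact I|assumption]|].
    simpl. unfold Rdist. lra.
Qed.

Lemma pow_ratio_small (r A : R) : 0 <= r < 1 -> 0 < A -> exists n : nat, r ^ n < A.
Proof.
  intros Hr HA.
  destruct (pow_lt_1_zero r) with (y := A) as [n Hn].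
  - rewrite Rabs_right; lra.
  - exact HA.
  - exists n. specialize (Hn n (le_n n)). apply Rabs_def2 in Hn. lra.
Qed.

(** If [f x0 > 0], the integrals of [f * sin * bump^n] vanish for all [n], yet near [x0] they
    contribute at least a constant times [rho'^n], while the negative contributions are at most a
    constant times [rho^n] with [rho < rho']. A large [n] gives the contradiction. *)
Lemma sine_orthogonal_nonpos (f : R -> R) :
  (forall x, continuous f x) -> sine_orthogonal f ->
  forall x0, 0 < x0 < PI -> f x0 <= 0.
Proof.
  intros Hc Hf x0 Hx0.
  destruct (Rle_lt_dec (f x0) 0) as [|Hpos]; [assumption|exfalso].
  (* Only the coefficient of index 1 is used: its weight [sin x] is positive on (0, PI) and does not
     affect signs. *)
  set (b := fun x => f x * sin x).
  assert (Hcb : forall x, continuous b x).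
  { intros x. apply continuous_mul; auto. apply continuous_derivable. auto_derive. auto. }
  assert (Hb0 : 0 < b x0).
  { apply Rmult_lt_0_compat; [assumption|]. apply sin_gt_0; lra. }
  set (eta := b x0 / 2).
  destruct (continuous_ball b x0 eta (Hcb x0)) as [d0 [Hd0 Hb]]. { unfold eta; lra. }
  set (d := Rmin d0 (Rmin (x0 / 2) ((PI - x0) / 2))).
  assert (Hd : 0 < d /\ d <= d0 /\ d <= x0 / 2 /\ d <= (PI - x0) / 2).
  { unfold d. pose proof (Rmin_l d0 (Rmin (x0 / 2) ((PI - x0) / 2))).
    pose proof (Rmin_r d0 (Rmin (x0 / 2) ((PI - x0) / 2))).
    pose proof (Rmin_l (x0 / 2) ((PI - x0) / 2)).
    pose proof (Rmin_r (x0 / 2) ((PI - x0) / 2)).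
    split; [|lra]. repeat apply Rmin_pos; lra. }
  clearbody d. destruct Hd as [Hd [Hdd0 [Hd1 Hd2]]].
  assert (Hnear : forall x, x0 - d <= x <= x0 + d -> eta < b x).
  { intros x Hx. assert (H : Rabs (b x - b x0) < eta).
    { apply Hb. apply Rabs_le. lra. }
    apply Rabs_def2 in H. unfold eta in *. lra. }
  destruct (bump_far x0 d) as [rho [Hrho Hfar]]; try lra.
  (* Halfway between [rho] and the peak value 1, leaving a strict ratio [rho / rho' < 1]. *)
  set (rho' := (1 + rho) / 2).
  destruct (continuous_ball (bump x0) x0 (1 - rho')) as [d1 [Hd1' Hbump]].
  { apply continuous_derivable. unfold bump. auto_derive. auto. }
  { unfold rho'. lra. }
  set (d' := Rmin d d1).
  assert (Hd' : 0 < d' /\ d' <= d /\ d' <= d1).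
  { unfold d'. split; [apply Rmin_pos; lra|]. split; [apply Rmin_l|apply Rmin_r]. }
  clearbody d'. destruct Hd' as [Hd' [Hd'd Hd'1]].
  assert (Hcenter : forall x, x0 - d' <= x <= x0 + d' -> rho' <= bump x0 x).
  { intros x Hx. assert (H : Rabs (bump x0 x - bump x0 x0) < 1 - rho').
    { apply Hbump. apply Rabs_le. lra. }
    apply Rabs_def2 in H. unfold bump in H at 2 4.
    replace (1 - (cos x0 - cos x0) ^ 2 / 4) with 1 in H by field. lra. }
  destruct (continuity_ab_min b 0 PI) as [xm [Hmin _]]. { lra. }
  { intros c _. apply continuity_pt_filterlim, Hcb. }
  set (M := Rabs (b xm)).
  assert (HM0 : 0 <= M) by apply Rabs_pos.
  assert (HM : forall x, 0 <= x <= PI -> - M <= b x).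
  { intros x Hx. specialize (Hmin x Hx). pose proof (Rabs_maj2 (b xm)). unfold M. lra. }
  set (k := fun n x => b x * bump x0 x ^ n).
  assert (Hck : forall n x, continuous (k n) x).
  { intros n x. apply continuous_mul; auto. apply continuous_bump_pow. }
  assert (Hex : forall n p q, ex_RInt (k n) p q).
  { intros n p q. apply ex_RInt_continuous_R, Hck. }
  assert (Heta : 0 < eta) by (unfold eta; lra).
  assert (Hrho'0 : 0 < rho') by (unfold rho'; lra).
  assert (Hzero : forall n, RInt (k n) 0 PI = 0).
  { intros n. etransitivity; [|exact (sine_orthogonal_bump x0 f n Hc Hf 1%nat)].
    apply RInt_ext. intros x _. unfold k, b. rewrite Rmult_1_l. simpl. ring. }
  (* Between distances [d'] and [d] from [x0] the bump may exceed [rho], but [b] is positive there.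
     Where [b] is negative, [x] is at distance at least [d] and [bump_far] applies. *)
  assert (Hout : forall n x, 0 <= x <= PI -> (x <= x0 - d' \/ x0 + d' <= x) ->
    - M * rho ^ n <= k n x).
  { intros n x Hx Hxd. unfold k.
    pose proof (bump_range x0 x) as [Hb1 Hb2].
    assert (Hrn : 0 <= rho ^ n) by (apply pow_le; lra).
    assert (Hbn : 0 <= bump x0 x ^ n) by (apply pow_le; lra).
    destruct (Rle_lt_dec 0 (b x)) as [Hp|Hn]; [nra|].
    assert (Hbr : bump x0 x ^ n <= rho ^ n).
    { apply pow_incr. split; [assumption|]. apply Hfar; [assumption|].
      destruct (Rle_lt_dec x (x0 - d)); [lra|].
      destruct (Rle_lt_dec (x0 + d) x); [lra|].
      specialize (Hnear x ltac:(lra)). lra. }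
    specialize (HM x Hx). nra. }
  assert (Hin : forall n x, x0 - d' <= x <= x0 + d' -> eta * rho' ^ n <= k n x).
  { intros n x Hx. unfold k.
    assert (H : rho' ^ n <= bump x0 x ^ n).
    { apply pow_incr. split; [lra|]. apply Hcenter. assumption. }
    assert (0 <= rho' ^ n) by (apply pow_le; lra).
    specialize (Hnear x ltac:(lra)). nra. }
  assert (Hconst : forall c p q n, p <= q -> (forall x, p < x < q -> c <= k n x) ->
    c * (q - p) <= RInt (k n) p q).
  { intros c p q n Hpq H.
    replace (c * (q - p)) with (RInt (fun _ => c) p q).
    - apply RInt_le; auto. apply ex_RInt_const.
    - rewrite RInt_const. unfold scal; simpl; unfold mult; simpl. ring. }
  assert (Hmain : forall n, eta * (2 * d') * rho' ^ n <= M * PI * rho ^ n).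
  { intros n. specialize (Hzero n).
    rewrite <- (RInt_Chasles (k n) 0 (x0 - d') PI) in Hzero by apply Hex.
    rewrite <- (RInt_Chasles (k n) (x0 - d') (x0 + d') PI) in Hzero by apply Hex.
    unfold plus in Hzero; simpl in Hzero.
    assert (H1 := Hconst (- M * rho ^ n) 0 (x0 - d') n ltac:(lra)
       (fun x Hx => Hout n x ltac:(lra) ltac:(lra))).
    assert (H2 := Hconst (eta * rho' ^ n) (x0 - d') (x0 + d') n ltac:(lra)
       (fun x Hx => Hin n x ltac:(lra))).
    assert (H3 := Hconst (- M * rho ^ n) (x0 + d') PI n ltac:(lra)
       (fun x Hx => Hout n x ltac:(lra) ltac:(lra))).
    assert (0 <= M * rho ^ n) by (apply Rmult_le_pos; [|apply pow_le]; lra).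
    nra. }
  pose proof PI_RGT_0.
  (* The added 1 keeps the denominator positive when [M = 0]. *)
  destruct (pow_ratio_small (rho / rho') (eta * (2 * d') / (M * PI + 1))) as [n Hn].
  { split.
    - apply Rmult_le_pos; [lra|]. left; apply Rinv_0_lt_compat; lra.
    - apply (Rmult_lt_reg_r rho'); [lra|]. unfold rho' at 1.
      replace (rho / ((1 + rho) / 2) * rho') with rho by (unfold rho'; field; lra).
      unfold rho'; lra. }
  { apply Rdiv_lt_0_compat; [|nra]. apply Rmult_lt_0_compat; lra. }
  specialize (Hmain n).
  assert (Hpn : 0 < rho' ^ n) by (apply pow_lt; lra).
  assert (HMP : 0 < M * PI + 1) by nra.
  assert (Hrr : rho ^ n = (rho / rho') ^ n * rho' ^ n).
  { rewrite <- Rpow_mult_distr. f_equal. field. lra. }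
  rewrite Hrr in Hmain.
  assert (Hq : 0 <= (rho / rho') ^ n).
  { apply pow_le. apply Rmult_le_pos; [lra|]. left; apply Rinv_0_lt_compat; lra. }
  assert (Hn' : (M * PI + 1) * (rho / rho') ^ n < eta * (2 * d')).
  { apply (Rmult_lt_compat_l (M * PI + 1)) in Hn; [|assumption].
    replace ((M * PI + 1) * (eta * (2 * d') / (M * PI + 1))) with (eta * (2 * d')) in Hn
      by (field; lra). exact Hn. }
  set (z := (rho / rho') ^ n) in *.
  assert (eta * (2 * d') <= M * PI * z).
  { apply (Rmult_le_reg_r (rho' ^ n)); [assumption|]. lra. }
  nra.
Qed.

Lemma sine_system_complete (f : R -> R) :
  (forall x, continuous f x) -> sine_orthogonal f -> forall x, 0 < x < PI -> f x = 0.
Proof.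
  intros Hc Hf x Hx.
  assert (H1 := sine_orthogonal_nonpos f Hc Hf x Hx).
  assert (Hc' : forall x, continuous (fun x => -1 * f x + 0 * f x) x).
  { intros z. apply continuous_lin; auto. }
  assert (H2 := sine_orthogonal_nonpos _ Hc' (sine_orthogonal_lin _ _ f f Hc Hc Hf Hf) x Hx).
  cbv beta in H2. lra.
Qed.

(** * Lower bound for the eigenvalues *)

Lemma cont2_continuity_2d_pt (f : R -> R -> R) (x y : R) :
  cont2 f -> continuity_2d_pt f x y.
Proof.
  intros Hf eps. destruct (Hf x y eps (cond_pos eps)) as [d [Hd H]].
  assert (Hd2 : 0 < d / 2) by lra.
  exists (mkposreal _ Hd2). simpl. intros u v Hu Hv. apply H.
  apply Rabs_def2 in Hu. apply Rabs_def2 in Hv. nra.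
Qed.

Lemma Rabs_lt_of_pow2 (a b d : R) : 0 < d -> a ^ 2 + b ^ 2 < d ^ 2 -> Rabs a < d.
Proof. intros Hd H. apply Rabs_def1; nra. Qed.

Lemma continuity_2d_pt_cont2 (f : R -> R -> R) :
  (forall x y, continuity_2d_pt f x y) -> cont2 f.
Proof.
  intros Hf x y eps He. destruct (Hf x y (mkposreal eps He)) as [d H].
  pose proof (cond_pos d) as Hd. exists d. split; [exact Hd|].
  intros x' y' Hxy. apply H.
  - apply (Rabs_lt_of_pow2 _ (y' - y)); assumption.
  - apply (Rabs_lt_of_pow2 _ (x' - x)); [assumption|]. rewrite Rplus_comm. exact Hxy.
Qed.

Lemma continuity_2d_pt_swap (f : R -> R -> R) (x y : R) :
  continuity_2d_pt f x y -> continuity_2d_pt (fun y x => f x y) y x.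
Proof.
  intros Hf eps. destruct (Hf eps) as [d H]. exists d. intros u v Hu Hv.
  apply H; assumption.
Qed.

Lemma cont2_continuous_x (f : R -> R -> R) (y x : R) :
  cont2 f -> continuous (fun x => f x y) x.
Proof.
  intros Hf. apply continuity_pt_filterlim. intros eps He.
  destruct (Hf x y eps He) as [d [Hd H]]. exists d. split; [exact Hd|].
  intros x' [_ Hx']. simpl in *. unfold Rdist in *. apply H.
  apply Rabs_def2 in Hx'. nra.
Qed.

Lemma sine_coeff_derive (m : nat) (f g : R -> R -> R) (y : R) :
  is_dy f g -> cont2 f -> cont2 g ->
  is_derive (fun y => sine_coeff m (fun x => f x y)) y (sine_coeff m (fun x => g x y)).
Proof.
  intros Hfg Hf Hg.
  assert (HD : forall t z, Derive (fun u => f t u * sin (INR m * t)) z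
    = g t z * sin (INR m * t)).
  { intros t z. apply is_derive_unique.
    apply (is_derive_ext (fun u => scal (sin (INR m * t)) (f t u))).
    { intros; apply Rmult_comm. }
    rewrite (Rmult_comm (g t z)). apply (is_derive_scal (f t)). apply is_derive_Reals, Hfg. }
  replace (sine_coeff m (fun x => g x y)) with
    (RInt (fun t => Derive (fun u => f t u * sin (INR m * t)) y) 0 PI).
  2:{ apply RInt_ext. intros x _. apply HD. }
  apply (is_derive_RInt_param (fun y x => f x y * sin (INR m * x))).
  - exists (mkposreal 1 Rlt_0_1). intros z _ t _.
    auto_derive. repeat split. exists (g t z). apply is_derive_Reals, Hfg.
  - intros t _.
    apply (continuity_2d_pt_ext (fun u v => g v u * sin (INR m * v))).
    { intros; symmetry; apply HD. }
    apply (continuity_2d_pt_mult (fun u v => g v u) (fun u v => sin (INR m * v))).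
    + apply continuity_2d_pt_swap, cont2_continuity_2d_pt, Hg.
    + apply (continuity_1d_2d_pt_comp (fun z => sin (INR m * z)) (fun u v => v)).
      * apply continuity_pt_derivable. auto_derive. auto.
      * apply continuity_2d_pt_id2.
  - exists (mkposreal 1 Rlt_0_1). intros z _. apply ex_RInt_mul_sin.
    intros x. apply cont2_continuous_x, Hf.
Qed.

Lemma sin_nat_PI (m : nat) : sin (INR m * PI) = 0.
Proof. apply sin_eq_0_1. exists (Z.of_nat m). rewrite INR_IZR_INZ. reflexivity. Qed.

(** Two integrations by parts at once: [f1 sin (m x) - m f cos (m x)] is a primitive of
    [(f2 + m^2 f) sin (m x)], and it vanishes at both ends. *)
Lemma sine_coeff_second_derivative (m : nat) (f f1 f2 : R -> R) :
  (forall x, is_derive f x (f1 x)) -> (forall x, is_derive f1 x (f2 x)) ->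
  (forall x, continuous f2 x) -> f 0 = 0 -> f PI = 0 ->
  sine_coeff m f2 = - INR m ^ 2 * sine_coeff m f.
Proof.
  intros D0 D1 Hc B0 B1.
  assert (Hcf : forall x, continuous f x).
  { intros x. apply continuous_derivable. eexists; apply D0. }
  assert (H : sine_coeff m (fun x => 1 * f2 x + INR m ^ 2 * f x) = 0).
  { unfold sine_coeff.
    transitivity (minus (f1 PI * sin (INR m * PI) - INR m * f PI * cos (INR m * PI))
      (f1 0 * sin (INR m * 0) - INR m * f 0 * cos (INR m * 0))).
    2:{ rewrite B0, B1, sin_nat_PI, !Rmult_0_r, sin_0. unfold minus, plus, opp; simpl. ring. }
    apply is_RInt_unique.
    apply (is_RInt_derive (fun x => f1 x * sin (INR m * x) - INR m * f x * cos (INR m * x))).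
    - intros x _. auto_derive.
      { repeat split; eexists; eauto. }
      rewrite_derive. ring.
    - intros x _. apply (continuous_mul (fun x => 1 * f2 x + INR m ^ 2 * f x)).
      + apply continuous_lin; auto.
      + apply continuous_derivable. auto_derive. auto. }
  rewrite sine_coeff_lin in H by assumption. lra.
Qed.

(** Applied twice along a vertical side, this turns [u = 0] into [u_yy = 0] there. *)
Lemma derive_zero_on_interval (f f1 : R -> R) (a b : R) :
  (forall y, is_derive f y (f1 y)) -> (forall y, a < y < b -> f y = 0) ->
  forall y, a < y < b -> f1 y = 0.
Proof.
  intros Hd H0 y Hy. rewrite <- (is_derive_unique _ _ _ (Hd y)).
  apply is_derive_unique. apply (is_derive_ext_loc (fun _ => 0)).
  2:{ apply (@is_derive_const R_AbsRing R_NormedModule). }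
  assert (He : 0 < Rmin (y - a) (b - y)) by (apply Rmin_pos; lra).
  exists (mkposreal _ He). intros z Hz. symmetry. apply H0.
  assert (Hz' : Rabs (z - y) < Rmin (y - a) (b - y)) by exact Hz.
  apply Rabs_def2 in Hz'.
  pose proof (Rmin_l (y - a) (b - y)). pose proof (Rmin_r (y - a) (b - y)). lra.
Qed.

(** The conditions on the horizontal sides become the clamped conditions of the sine coefficients;
    those on the vertical sides remove the boundary terms of the integrations by parts in [x]. Below
    the bound every coefficient vanishes, so completeness contradicts the nontriviality of [u]. *)
Lemma eigenvalue_lower_bound (s t l mu : R) :
  s ^ 2 + t ^ 2 < PI ^ 2 ->
  (forall s' t', 0 < s' -> 0 <= t' -> s' ^ 2 + t' ^ 2 < s ^ 2 + t ^ 2 ->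
      0 < dispersion s' t') ->
  0 < l -> eigenvalue l mu -> s ^ 2 + t ^ 2 <= mu * l ^ 2.
Proof.
  intros HPI Hdisp Hl [u [D [[Du [Dx [Dy DC]]] [Hnz [HE [HB [HBy HBx]]]]]]].
  destruct (Rle_lt_dec (s ^ 2 + t ^ 2) (mu * l ^ 2)) as [|Hlt]; [assumption|exfalso].
  pose proof PI_RGT_0 as HPI0.
  assert (DRx : forall i j x y, (i + j < 4)%nat ->
    is_derive (fun x => D i j x y) x (D (S i) j x y)).
  { intros i j x y Hij. apply is_derive_Reals, (Dx i j Hij). }
  assert (DRy : forall i j x y, (i + j < 4)%nat ->
    is_derive (D i j x) y (D i (S j) x y)).
  { intros i j x y Hij. apply is_derive_Reals, (Dy i j Hij). }
  assert (DCx : forall i j x y, (i + j <= 4)%nat -> continuous (fun x => D i j x y) x).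
  { intros i j x y Hij. apply cont2_continuous_x, DC, Hij. }
  assert (Hside : forall x, x = 0 \/ x = PI -> forall y, - l < y < l ->
    D 0%nat 0%nat x y = 0 /\ D 0%nat 2%nat x y = 0).
  { intros x Hx.
    assert (H0 : forall y, - l < y < l -> D 0%nat 0%nat x y = 0).
    { intros y Hy. rewrite Du. apply HB. unfold on_boundary, in_closure, in_Omega. lra. }
    assert (H1 := derive_zero_on_interval (D 0%nat 0%nat x) (D 0%nat 1%nat x) (- l) l
      ltac:(intros; apply DRy; lia) H0).
    assert (H2 := derive_zero_on_interval (D 0%nat 1%nat x) (D 0%nat 2%nat x) (- l) l
      ltac:(intros; apply DRy; lia) H1).
    auto. }
  destruct Hnz as [x0 [y0 [[Hx0 Hy0] Hu]]]. apply Hu. rewrite <- Du.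
  apply (sine_system_complete (fun x => D 0%nat 0%nat x y0)); [|clear x0 Hx0 Hu|exact Hx0].
  { intros x; apply DCx; lia. }
  intros m. destruct m as [|m']; [apply sine_coeff_0|].
  set (m := S m'). assert (Hm : 0 < INR m) by apply lt_0_INR, Nat.lt_0_succ.
  set (a := fun i j y => sine_coeff m (fun x => D i j x y)).
  change (a 0%nat 0%nat y0 = 0).
  assert (Da : forall j y, (j < 4)%nat -> is_derive (a 0%nat j) y (a 0%nat (S j) y)).
  { intros j y Hj. apply sine_coeff_derive; [apply Dy|apply DC|apply DC]; lia. }
  apply (clamped_mode_trivial s t (INR m) l mu (a 0%nat 0%nat) (a 0%nat 1%nat)
    (a 0%nat 2%nat) (a 0%nat 3%nat) (a 0%nat 4%nat)); try assumption;
    try (intros; apply Da; lia).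
  - apply sine_coeff_zero. intros x Hx. rewrite Du. apply HB.
    unfold on_boundary, in_closure, in_Omega. lra.
  - apply sine_coeff_zero. intros x Hx. rewrite Du. apply HB.
    unfold on_boundary, in_closure, in_Omega. lra.
  - apply sine_coeff_zero. intros x Hx. apply HBy, Hx.
  - apply sine_coeff_zero. intros x Hx. apply HBy, Hx.
  - intros y Hy.
    destruct (Hside 0 (or_introl eq_refl) y Hy) as [S00 S02].
    destruct (Hside PI (or_intror eq_refl) y Hy) as [T00 T02].
    destruct (HBx y Hy) as [S20 T20].
    (* Used for [u], [u_yy] and [u_xx], all zero on the vertical sides; the last combined with the
       first produces the factor [m^4] for [u_xxxx]. *)
    assert (Hxx : forall i j, (i + j <= 2)%nat -> D i j 0 y = 0 -> D i j PI y = 0 ->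
      a (S (S i)) j y = - INR m ^ 2 * a i j y).
    { intros i j Hij H0 H1.
      apply (sine_coeff_second_derivative m _ (fun x => D (S i) j x y)); try assumption.
      - intros x; apply DRx; lia.
      - intros x; apply DRx; lia.
      - intros x; apply DCx; lia. }
    assert (E20 := Hxx 0%nat 0%nat ltac:(lia) S00 T00).
    assert (E22 := Hxx 0%nat 2%nat ltac:(lia) S02 T02).
    assert (E40 := Hxx 2%nat 0%nat ltac:(lia) S20 T20).
    assert (HC : forall i j, (i + j <= 4)%nat -> forall x, continuous (fun x => D i j x y) x).
    { intros; apply DCx; assumption. }
    assert (HL : a 4%nat 0%nat y + 2 * a 2%nat 2%nat y + a 0%nat 4%nat y
      = - mu * (a 2%nat 0%nat y + a 0%nat 2%nat y)).
    { unfold a.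
      transitivity (sine_coeff m (fun x => 1 * (1 * D 4%nat 0%nat x y + 2 * D 2%nat 2%nat x y)
         + 1 * D 0%nat 4%nat x y)).
      { rewrite !sine_coeff_lin; try ring; try (intros; apply continuous_lin); apply HC; lia. }
      transitivity (sine_coeff m (fun x => - mu * D 2%nat 0%nat x y + - mu * D 0%nat 2%nat x y)).
      { apply sine_coeff_ext. intros x Hx. specialize (HE x y (conj Hx Hy)). lra. }
      rewrite sine_coeff_lin; [ring| |]; apply HC; lia. }
    rewrite E40, E22, E20 in HL. lra.
Qed.

(** * The extremal eigenfunction *)

(** A quarter-turn phase shift per derivative puts derivatives of every order in closed form, so
    that the family required by [C4_with] is available uniformly in the order. *)
Definition sin_deriv (k : R) (i : nat) (x : R) : R := k ^ i * sin (k * x + INR i * (PI / 2)).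

Definition cos_deriv (w : R) (j : nat) (y : R) : R := w ^ j * cos (w * y + INR j * (PI / 2)).

Definition cosh_deriv (k : R) (j : nat) (y : R) : R :=
  (k ^ j * exp (k * y) + (- k) ^ j * exp (- (k * y))) / 2.

(** The coefficients make the profile ([j = 0]) vanish at [- l] and [l]. Its derivative at [l] is
    then [- dispersion (k * l) (w * l) / l], so the second clamped condition is the dispersion
    relation. *)
Definition profile_deriv (k w l : R) (j : nat) (y : R) : R :=
  cosh (k * l) * cos_deriv w j y - cos (w * l) * cosh_deriv k j y.

Lemma is_derive_sin_deriv (k : R) (i : nat) (x : R) :
  is_derive (sin_deriv k i) x (sin_deriv k (S i) x).
Proof.
  unfold sin_deriv. auto_derive; [auto|].
  replace (k * x + INR (S i) * (PI / 2)) with (PI / 2 + (k * x + INR i * (PI / 2)))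
    by (rewrite S_INR; field).
  rewrite <- cos_sin. simpl. ring.
Qed.

Lemma is_derive_profile_deriv (k w l : R) (j : nat) (y : R) :
  is_derive (profile_deriv k w l j) y (profile_deriv k w l (S j) y).
Proof.
  unfold profile_deriv, cos_deriv, cosh_deriv. auto_derive; [auto|].
  replace (w * y + INR (S j) * (PI / 2)) with (PI / 2 + (w * y + INR j * (PI / 2)))
    by (rewrite S_INR; field).
  rewrite (sin_cos (w * y + INR j * (PI / 2))). simpl. field.
Qed.

Lemma sin_deriv_0 (k x : R) : sin_deriv k 0 x = sin (k * x).
Proof. unfold sin_deriv. simpl. rewrite Rmult_0_l, Rplus_0_r. ring. Qed.

Lemma sin_deriv_SS (k : R) (i : nat) (x : R) :
  sin_deriv k (S (S i)) x = - k ^ 2 * sin_deriv k i x.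
Proof.
  unfold sin_deriv. rewrite !S_INR.
  replace (k * x + (INR i + 1 + 1) * (PI / 2)) with (k * x + INR i * (PI / 2) + PI) by field.
  rewrite neg_sin. simpl. ring.
Qed.

Lemma cos_deriv_SS (w : R) (j : nat) (y : R) :
  cos_deriv w (S (S j)) y = - w ^ 2 * cos_deriv w j y.
Proof.
  unfold cos_deriv. rewrite !S_INR.
  replace (w * y + (INR j + 1 + 1) * (PI / 2)) with (w * y + INR j * (PI / 2) + PI) by field.
  rewrite neg_cos. simpl. ring.
Qed.

Lemma cosh_deriv_SS (k : R) (j : nat) (y : R) :
  cosh_deriv k (S (S j)) y = k ^ 2 * cosh_deriv k j y.
Proof. unfold cosh_deriv. simpl. field. Qed.

Lemma profile_deriv_0 (k w l y : R) :
  profile_deriv k w l 0 y = cosh (k * l) * cos (w * y) - cos (w * l) * cosh (k * y).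
Proof.
  unfold profile_deriv, cos_deriv, cosh_deriv, cosh. simpl.
  rewrite Rmult_0_l, Rplus_0_r. field.
Qed.

Lemma profile_deriv_1 (k w l y : R) :
  profile_deriv k w l 1 y
  = - w * cosh (k * l) * sin (w * y) - k * cos (w * l) * sinh (k * y).
Proof.
  unfold profile_deriv, cos_deriv, cosh_deriv, cosh, sinh. simpl.
  rewrite Rmult_1_l, (Rplus_comm (w * y)), (sin_cos (w * y)). field.
Qed.

(** The first term of [dispersion] is positive, so the cosine term must compensate it. This sign is
    what makes the profile positive. *)
Lemma dispersion_zero_cos_neg (s t : R) :
  0 < s -> 0 < t < PI -> dispersion s t = 0 -> cos t < 0.
Proof.
  intros Hs Ht H. unfold dispersion in H.
  assert (H1 : 0 < t * sin t * cosh s).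
  { apply Rmult_lt_0_compat; [apply Rmult_lt_0_compat|]; try apply cosh_pos; try lra.
    apply sin_gt_0; lra. }
  assert (H2 : 0 < s * sinh s) by (apply Rmult_lt_0_compat; [|apply sinh_pos]; lra).
  nra.
Qed.

(* The derivative of the profile vanishes at 0 and at [l] and is strictly convex in between,
   hence negative, so the profile decreases to its value 0 at [l]. *)
Lemma profile_pos_right (k w l y : R) :
  0 < k -> 0 < w -> w * l < PI -> dispersion (k * l) (w * l) = 0 ->
  0 < y < l -> 0 < profile_deriv k w l 0 y.
Proof.
  intros Hk Hw HwP Hd Hy.
  assert (Hl : 0 < l) by lra.
  assert (Hkl : 0 < k * l) by (apply Rmult_lt_0_compat; lra).
  assert (Hwl : 0 < w * l) by (apply Rmult_lt_0_compat; lra).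
  assert (Hc : cos (w * l) < 0) by (apply (dispersion_zero_cos_neg (k * l)); auto).
  set (P := profile_deriv k w l).
  assert (HD : forall j z, is_derive (P j) z (P (S j) z))
    by (intros; apply is_derive_profile_deriv).
  assert (H10 : P 1%nat 0 = 0).
  { unfold P. rewrite profile_deriv_1, !Rmult_0_r, sin_0, sinh_0. ring. }
  assert (H1l : P 1%nat l = 0).
  { unfold P. rewrite profile_deriv_1.
    apply (Rmult_eq_reg_r l); [|lra]. unfold dispersion in Hd. lra. }
  assert (H0l : P 0%nat l = 0) by (unfold P; rewrite profile_deriv_0; ring).
  assert (H3 : forall z, 0 < z < l -> 0 < P 3%nat z).
  { intros z Hz. replace (P 3%nat z) with
      (w ^ 2 * (w * cosh (k * l) * sin (w * z)) + k ^ 2 * (- cos (w * l) * (k * sinh (k * z)))).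
    - assert (w * z < w * l) by (apply Rmult_lt_compat_l; lra).
      assert (0 < sin (w * z)) by (apply sin_gt_0; [apply Rmult_lt_0_compat|]; lra).
      assert (0 < sinh (k * z)) by (apply sinh_pos, Rmult_lt_0_compat; lra).
      pose proof (cosh_pos (k * l)).
      apply Rplus_lt_0_compat;
        repeat first [assumption | lra | apply pow_lt | apply Rmult_lt_0_compat].
    - assert (H := profile_deriv_1 k w l z). unfold P, profile_deriv in *.
      rewrite cos_deriv_SS, cosh_deriv_SS.
      unfold cos_deriv, cosh_deriv, cosh, sinh. simpl.
      rewrite Rmult_1_l, (Rplus_comm (w * z)), (sin_cos (w * z)). field. }
  assert (H1 : forall z, 0 < z < l -> P 1%nat z < 0).
  (* If [P 1] were nonnegative at [z], its zeros at 0 and [l] would give [P 2 a >= 0 >= P 2 b] with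
     [a < z < b], although [P 2] increases strictly. *)
  { intros z Hz. destruct (Rlt_le_dec (P 1%nat z) 0) as [|Hge]; [assumption|exfalso].
    destruct (MVT_cor2 (P 1%nat) (P 2%nat) 0 z) as [a [Ha Ha']]; [lra| |].
    { intros c _. apply is_derive_Reals, HD. }
    destruct (MVT_cor2 (P 1%nat) (P 2%nat) z l) as [b [Hb Hb']]; [lra| |].
    { intros c _. apply is_derive_Reals, HD. }
    assert (P 2%nat a < P 2%nat b).
    { apply (is_derive_incr (P 2%nat) (P 3%nat)); [lra|auto|].
      intros x Hx. apply H3. lra. }
    assert (0 <= P 2%nat a) by nra.
    assert (P 2%nat b <= 0) by nra.
    lra. }
  destruct (MVT_cor2 (P 0%nat) (P 1%nat) y l) as [a [Ha Ha']]; [lra| |].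
  { intros c _. apply is_derive_Reals, HD. }
  specialize (H1 a ltac:(lra)). nra.
Qed.

Lemma profile_pos (k w l y : R) :
  0 < k -> 0 < w -> 0 < l -> w * l < PI -> dispersion (k * l) (w * l) = 0 ->
  - l < y < l -> 0 < profile_deriv k w l 0 y.
Proof.
  intros Hk Hw Hl HwP Hd Hy.
  destruct (Rtotal_order y 0) as [Hlt|[->|Hgt]].
  - replace (profile_deriv k w l 0 y) with (profile_deriv k w l 0 (- y)).
    + apply profile_pos_right; auto; lra.
    + rewrite !profile_deriv_0, !Ropp_mult_distr_r_reverse, cosh_opp, cos_neg. reflexivity.
  - rewrite profile_deriv_0, !Rmult_0_r, cos_0, cosh_0.
    assert (cos (w * l) < 0).
    { apply (dispersion_zero_cos_neg (k * l)); auto; [|split; [|assumption]];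
        apply Rmult_lt_0_compat; lra. }
    pose proof (cosh_pos (k * l)). lra.
  - apply profile_pos_right; auto; lra.
Qed.

Definition mode (k w l x y : R) : R := sin_deriv k 0 x * profile_deriv k w l 0 y.

Lemma mode_eigenfunction (n : nat) (w l : R) :
  (1 <= n)%nat -> 0 < w -> 0 < l -> w * l < PI ->
  dispersion (INR n * l) (w * l) = 0 ->
  eigenfunction l (INR n ^ 2 + w ^ 2) (mode (INR n) w l).
Proof.
  intros Hn Hw Hl HwP Hd. set (k := INR n) in *.
  assert (Hk : 1 <= k) by (apply (le_INR 1); exact Hn).
  pose proof PI_RGT_0 as HPI.
  exists (fun i j x y => sin_deriv k i x * profile_deriv k w l j y).
  assert (Bx : forall x, x = 0 \/ x = PI -> sin_deriv k 0 x = 0).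
  { intros x [->| ->]; rewrite sin_deriv_0.
    - rewrite Rmult_0_r. apply sin_0.
    - apply sin_nat_PI. }
  assert (By : forall y, y = - l \/ y = l -> profile_deriv k w l 0 y = 0).
  { intros y [->| ->]; rewrite profile_deriv_0;
      rewrite ?Ropp_mult_distr_r_reverse, ?cosh_opp, ?cos_neg; ring. }
  assert (By' : forall y, y = - l \/ y = l -> profile_deriv k w l 1 y = 0).
  { assert (E : profile_deriv k w l 1 l = 0).
    { rewrite profile_deriv_1. apply (Rmult_eq_reg_r l); [|lra].
      unfold dispersion in Hd. lra. }
    intros y [->| ->]; [|exact E]. rewrite profile_deriv_1 in *.
    rewrite !Ropp_mult_distr_r_reverse, sinh_opp, sin_neg. lra. }
  split; [split; [reflexivity|split; [|split]]|split; [|split; [|split; [|split]]]].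
  - intros i j _ x y. apply is_derive_Reals.
    apply (is_derive_ext (fun t => scal (profile_deriv k w l j y) (sin_deriv k i t))).
    { intros; apply Rmult_comm. }
    rewrite Rmult_comm. apply (is_derive_scal (sin_deriv k i)), is_derive_sin_deriv.
  - intros i j _ x y. apply is_derive_Reals.
    apply (is_derive_scal (profile_deriv k w l j)), is_derive_profile_deriv.
  - intros i j _. apply continuity_2d_pt_cont2. intros x y.
    apply (continuity_2d_pt_mult (fun x y => sin_deriv k i x) (fun x y => profile_deriv k w l j y)).
    + apply (continuity_1d_2d_pt_comp (sin_deriv k i) (fun x y => x)).
      * apply continuity_pt_derivable. eexists; apply is_derive_sin_deriv.
      * apply continuity_2d_pt_id1.
    + apply (continuity_1d_2d_pt_comp (profile_deriv k w l j) (fun x y => y)).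
      * apply continuity_pt_derivable. eexists; apply is_derive_profile_deriv.
      * apply continuity_2d_pt_id2.
  (* The first maximum of [sin (k x)], on the axis of symmetry. *)
  - exists (PI / (2 * k)), 0.
    assert (Hq : 0 < PI / (2 * k)) by (apply Rdiv_lt_0_compat; lra).
    assert (Hq' : PI / (2 * k) * k = PI / 2) by (field; lra).
    split. { unfold in_Omega. nra. }
    unfold mode. rewrite sin_deriv_0.
    replace (k * (PI / (2 * k))) with (PI / 2) by (field; lra).
    rewrite sin_PI2, Rmult_1_l. apply Rgt_not_eq, profile_pos; auto; lra.
  (* The cosine part of the mode is an eigenfunction of the Laplacian for [- (k^2 + w^2)] and the
     hyperbolic part is harmonic, so each solves the equation. *)
  - intros x y _. rewrite !sin_deriv_SS. unfold profile_deriv.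
    rewrite !cos_deriv_SS, !cosh_deriv_SS. ring.
  - intros x y [Hc Ho]. unfold mode.
    assert (H : (x = 0 \/ x = PI) \/ (y = - l \/ y = l)).
    { unfold in_closure, in_Omega in *.
      destruct (Req_dec x 0); [tauto|]. destruct (Req_dec x PI); [tauto|].
      destruct (Req_dec y (- l)); [tauto|]. destruct (Req_dec y l); [tauto|].
      exfalso. apply Ho. lra. }
    destruct H as [H|H]; [rewrite Bx by exact H|rewrite By by exact H]; ring.
  - intros x _. rewrite !By' by auto. split; ring.
  - intros y _. rewrite !sin_deriv_SS, !Bx by auto. split; ring.
Qed.

(** * Nodal domains *)

(** Connectedness of [0, 1] with relatively open sets. Let [r] be the supremum of the initial
    stretches lying in [A]: if [A] held at [r] the stretch would extend, and if [B] held there it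
    would meet the stretch. *)
Lemma unit_interval_not_separated (A B : R -> Prop) (t0 t1 : R) :
  (forall t, 0 <= t <= 1 -> A t -> exists e, 0 < e /\
     forall t', 0 <= t' <= 1 -> Rabs (t' - t) < e -> A t') ->
  (forall t, 0 <= t <= 1 -> B t -> exists e, 0 < e /\
     forall t', 0 <= t' <= 1 -> Rabs (t' - t) < e -> B t') ->
  (forall t, 0 <= t <= 1 -> A t \/ B t) ->
  (forall t, 0 <= t <= 1 -> A t -> B t -> False) ->
  0 <= t0 -> t1 <= 1 -> t0 <= t1 -> A t0 -> B t1 -> False.
Proof.
  intros HA HB Hcov Hdis H0 H1 H01 HA0 HB1.
  destruct (completeness (fun t => t0 <= t <= t1 /\ forall s, t0 <= s <= t -> A s))
    as [r [Hub Hlub]].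
  { exists t1. intros t Ht. lra. }
  { exists t0. split; [lra|]. intros s Hs. replace s with t0 by lra. exact HA0. }
  assert (Hr0 : t0 <= r).
  { apply Hub. split; [lra|]. intros s Hs. replace s with t0 by lra. exact HA0. }
  assert (Hr1 : r <= t1) by (apply Hlub; intros t Ht; lra).
  assert (Hbelow : forall e, 0 < e -> exists t, r - e < t <= r /\ t0 <= t /\
     forall s, t0 <= s <= t -> A s).
  { intros e He.
    destruct (Classical_Prop.classic (exists t, r - e < t <= r /\ t0 <= t /\
      forall s, t0 <= s <= t -> A s)) as [|Hn]; [assumption|exfalso].
    assert (r <= r - e); [|lra].
    apply Hlub. intros t Ht. destruct (Rle_lt_dec t (r - e)); [assumption|].
    exfalso. apply Hn. exists t. pose proof (Hub t Ht).
    split; [lra|]. split; [lra|]. apply Ht. }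
  destruct (Hcov r ltac:(lra)) as [HAr|HBr].
  - destruct (HA r ltac:(lra) HAr) as [e [He Hball]].
    destruct (Hbelow e He) as [t [Ht [Ht0 Hs]]].
    assert (Hrt : r < t1).
    { destruct (Req_dec r t1) as [E|]; [|lra]. exfalso.
      apply (Hdis r); [lra|exact HAr|]. rewrite E. exact HB1. }
    set (r' := Rmin (r + e / 2) t1).
    assert (Hr'1 : r' <= r + e / 2) by apply Rmin_l.
    assert (Hr'2 : r' <= t1) by apply Rmin_r.
    assert (Hr'3 : r < r') by (apply Rmin_glb_lt; lra).
    assert (r' <= r); [|lra].
    apply Hub. split; [lra|]. intros s Hs'.
    destruct (Rle_lt_dec s t); [apply Hs; lra|].
    apply Hball; [lra|]. apply Rabs_def1; lra.
  - destruct (HB r ltac:(lra) HBr) as [e [He Hball]].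
    destruct (Hbelow e He) as [t [Ht [Ht0 Hs]]].
    apply (Hdis t); [lra|apply Hs; lra|].
    apply Hball; [lra|]. apply Rabs_def1; lra.
Qed.

Definition segment (p q : R * R) (x y : R) : Prop :=
  exists t, 0 <= t <= 1 /\
    x = fst p + t * (fst q - fst p) /\ y = snd p + t * (snd q - snd p).

(** The parametrisation is Lipschitz with constant [L = 1 + |a| + |b|]; the 1 keeps [L] positive
    when the endpoints coincide. *)
Lemma open2_segment (p q : R * R) (U : R -> R -> Prop) (t : R) :
  open2 U -> U (fst p + t * (fst q - fst p)) (snd p + t * (snd q - snd p)) ->
  exists e, 0 < e /\ forall t', Rabs (t' - t) < e ->
    U (fst p + t' * (fst q - fst p)) (snd p + t' * (snd q - snd p)).
Proof.
  intros HU Ht. destruct (HU _ _ Ht) as [e [He Hball]].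
  set (a := fst q - fst p) in *. set (b := snd q - snd p) in *.
  set (L := 1 + Rabs a + Rabs b).
  pose proof (Rabs_pos a) as Ha. pose proof (Rabs_pos b) as Hb.
  assert (HL : 0 < L) by (unfold L; lra).
  exists (e / L). split; [apply Rdiv_lt_0_compat; lra|].
  intros t' Ht'. apply Hball.
  replace ((fst p + t' * a - (fst p + t * a)) ^ 2 + (snd p + t' * b - (snd p + t * b)) ^ 2)
    with ((t' - t) ^ 2 * (a ^ 2 + b ^ 2)) by ring.
  assert (Hab : a ^ 2 + b ^ 2 <= L ^ 2).
  { rewrite <- (pow2_abs a), <- (pow2_abs b). unfold L. nra. }
  assert (Htt : Rabs (t' - t) * L < e).
  { apply (Rmult_lt_compat_r L) in Ht'; [|exact HL].
    replace (e / L * L) with e in Ht' by (field; lra). exact Ht'. }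
  rewrite <- (pow2_abs (t' - t)). pose proof (Rabs_pos (t' - t)).
  set (z := Rabs (t' - t)) in *.
  apply Rle_lt_trans with ((z * L) ^ 2).
  - rewrite Rpow_mult_distr. apply Rmult_le_compat_l; [apply pow2_ge_0|exact Hab].
  - assert (0 <= z * L) by nra. nra.
Qed.

Lemma connected2_segment (p q : R * R) : connected2 (segment p q).
Proof.
  intros [U [V [HU [HV [Hcov [Hdis [[x0 [y0 [[t0 [Ht0 [-> ->]]] HU0]]]
    [x1 [y1 [[t1 [Ht1 [-> ->]]] HV1]]]]]]]]]].
  set (P := fun (W : R -> R -> Prop) t =>
    W (fst p + t * (fst q - fst p)) (snd p + t * (snd q - snd p))).
  assert (Hin : forall t, 0 <= t <= 1 ->
    segment p q (fst p + t * (fst q - fst p)) (snd p + t * (snd q - snd p))).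
  { intros t Ht. exists t. auto. }
  assert (Hop : forall W, open2 W -> forall t, 0 <= t <= 1 -> P W t -> exists e, 0 < e /\
     forall t', 0 <= t' <= 1 -> Rabs (t' - t) < e -> P W t').
  { intros W HW t _ HPt. destruct (open2_segment p q W t HW HPt) as [e [He H]].
    exists e. split; [exact He|]. intros t' _. apply H. }
  destruct (Rle_lt_dec t0 t1).
  - apply (unit_interval_not_separated (P U) (P V) t0 t1); auto; try lra.
    + intros t Ht. apply Hcov, Hin, Ht.
    + intros t Ht. apply Hdis, Hin, Ht.
  - apply (unit_interval_not_separated (P V) (P U) t1 t0); auto; try lra.
    + intros t Ht. destruct (Hcov _ _ (Hin t Ht)); auto.
    + intros t Ht H1 H2. exact (Hdis _ _ (Hin t Ht) H2 H1).
Qed.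

Lemma segment_strict_bound (a b x z t : R) :
  a < x < b -> a < z < b -> 0 <= t <= 1 -> a < x + t * (z - x) < b.
Proof.
  intros Hx Hz Ht. destruct (Rle_lt_dec t (1 / 2)); split; nra.
Qed.

Lemma open2_left (a : R) : open2 (fun x _ => x < a).
Proof.
  intros x y Hx. exists (a - x). split; [lra|]. intros x' y' H.
  apply Rabs_lt_of_pow2 in H; [|lra]. apply Rabs_def2 in H. lra.
Qed.

Lemma open2_right (a : R) : open2 (fun x _ => a < x).
Proof.
  intros x y Hx. exists (x - a). split; [lra|]. intros x' y' H.
  apply Rabs_lt_of_pow2 in H; [|lra]. apply Rabs_def2 in H. lra.
Qed.

Lemma vertical_line_separates (S : R -> R -> Prop) (a : R) (p q : R * R) :
  (forall y, ~ S a y) -> fst p < a < fst q -> ~ same_component S p q.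
Proof.
  intros Ha Hpq [C [HCS [HC [Cp Cq]]]]. apply HC.
  exists (fun x _ => x < a), (fun x _ => a < x).
  split; [apply open2_left|]. split; [apply open2_right|].
  split. { intros x y Hxy. destruct (Rtotal_order x a) as [|[->|]]; auto.
           exfalso. exact (Ha y (HCS _ _ Hxy)). }
  split. { intros x y _ H1 H2. lra. }
  split; [exists (fst p), (snd p)|exists (fst q), (snd q)]; split; auto; lra.
Qed.

Lemma same_component_sym (S : R -> R -> Prop) (p q : R * R) :
  same_component S p q -> same_component S q p.
Proof. intros [C [H1 [H2 [H3 H4]]]]. exists C. auto. Qed.

(** The zero set cuts the rectangle into [n] open strips of width [h = PI / n]. Each strip is
    convex, so a segment joins any of its points to its centre, and the zero lines separate
    different strips. *)
Lemma num_nodal_domains_strips (l : R) (u : R -> R -> R) (n : nat) :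
  0 < l -> (1 <= n)%nat ->
  (forall x y, in_Omega l x y ->
     (u x y = 0 <-> exists j : nat, INR n * x = INR j * PI)) ->
  num_nodal_domains l u n.
Proof.
  intros Hl Hn Hu. pose proof PI_RGT_0 as HPI.
  assert (Hk : 1 <= INR n) by (apply (le_INR 1); exact Hn).
  set (S := fun x y => in_Omega l x y /\ u x y <> 0).
  set (h := PI / INR n).
  assert (Hh : 0 < h) by (apply Rdiv_lt_0_compat; lra).
  assert (Hnh : INR n * h = PI) by (unfold h; field; lra).
  assert (HS : forall i x y, (i < n)%nat -> INR i * h < x < (INR i + 1) * h -> - l < y < l ->
    S x y).
  { intros i x y Hi Hx Hy.
    assert (Hi1 : INR i + 1 <= INR n).
    { rewrite <- S_INR. apply le_INR. exact Hi. }
    assert (Hi0 := pos_INR i).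
    assert (HO : in_Omega l x y) by (unfold in_Omega; nra).
    split; [exact HO|]. rewrite (Hu x y HO). intros [j Hj].
    assert (Hxj : x = INR j * h).
    { apply (Rmult_eq_reg_l (INR n)); [|lra]. rewrite Hj, <- Hnh. ring. }
    rewrite Hxj in Hx.
    assert (H1 : INR i < INR j) by nra.
    assert (H2 : INR j < INR i + 1) by nra.
    rewrite <- S_INR in H2. apply INR_lt in H1. apply INR_lt in H2. lia. }
  exists (fun i => ((INR i + 1 / 2) * h, 0)).
  split; [|split].
  - intros i Hi. simpl. apply (HS i); [exact Hi|nra|lra].
  - assert (Hlt : forall i j, (i < j)%nat ->
      ~ same_component S ((INR i + 1 / 2) * h, 0) ((INR j + 1 / 2) * h, 0)).
    { intros i j Hij. apply (vertical_line_separates S (INR j * h)).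
      - intros y [HO Hy]. apply Hy, (Hu _ _ HO). exists j. rewrite <- Hnh. ring.
      - simpl. assert (INR i + 1 <= INR j) by (rewrite <- S_INR; apply le_INR; exact Hij).
        nra. }
    intros i j _ _ Hij. destruct (Nat.lt_total i j) as [H|[H|H]]; [auto|lia|].
    intros Hs. apply (Hlt j i H). apply same_component_sym, Hs.
  - intros x y HSxy. destruct (HSxy) as [HO Hne].
    assert (Hx : 0 < x < PI) by apply HO. assert (Hy : - l < y < l) by apply HO.
    (* The strip index is the floor of [x / h]; equality at the left edge is excluded because [u]
       vanishes there. *)
    destruct (nfloor_ex (x / h)) as [i Hi].
    { apply Rmult_le_pos; [lra|]. left; apply Rinv_0_lt_compat; lra. }
    assert (Hxh : x / h * h = x) by (field; lra).
    assert (Hi1 : INR i * h <= x < (INR i + 1) * h) by nra.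
    assert (Hi2 : INR i * h <> x).
    { intros E. apply Hne, (Hu _ _ HO). exists i. rewrite <- E, <- Hnh. ring. }
    assert (Hin : (i < n)%nat).
    { apply INR_lt. nra. }
    exists i. split; [exact Hin|].
    exists (segment (x, y) ((INR i + 1 / 2) * h, 0)).
    split; [|split; [apply connected2_segment|split]].
    + intros x' y' [t [Ht [-> ->]]]. simpl.
      apply (HS i); [exact Hin| |]; apply segment_strict_bound; auto; try lra; nra.
    + exists 0. split; [lra|]. simpl. split; ring.
    + exists 1. split; [lra|]. simpl. split; ring.
Qed.

(** * The widths [s / k] and the conclusion *)

Lemma INR_pos_of_ge_1 (n : nat) : (1 <= n)%nat -> 0 < INR n.
Proof. intros Hn. apply lt_0_INR. lia. Qed.

Lemma Un_cv_div_INR (s : R) (ell : nat -> R) :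
  0 < s -> (forall k, (1 <= k)%nat -> ell k = s / INR k) -> Un_cv ell 0.
Proof.
  intros Hs Hell eps He.
  destruct (nfloor_ex (s / eps)) as [N HN].
  { left. apply Rdiv_lt_0_compat; assumption. }
  exists (S N). intros k Hk. rewrite Hell by lia.
  assert (Hk0 : 0 < INR k) by (apply INR_pos_of_ge_1; lia).
  assert (HkN : INR N + 1 <= INR k) by (rewrite <- S_INR; apply le_INR; exact Hk).
  unfold Rdist. rewrite Rminus_0_r, Rabs_right.
  - apply (Rmult_lt_reg_r (INR k)); [assumption|].
    replace (s / INR k * INR k) with (s / eps * eps) by (field; lra).
    nra.
  - left. apply Rdiv_lt_0_compat; assumption.
Qed.

Lemma mode_zero_iff (n : nat) (w l x y : R) :
  (1 <= n)%nat -> 0 < w -> 0 < l -> w * l < PI ->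
  dispersion (INR n * l) (w * l) = 0 -> in_Omega l x y ->
  (mode (INR n) w l x y = 0 <-> exists j : nat, INR n * x = INR j * PI).
Proof.
  intros Hn Hw Hl HwP Hd [Hx Hy].
  assert (Hn0 := INR_pos_of_ge_1 n Hn).
  assert (Hp : 0 < profile_deriv (INR n) w l 0 y) by (apply profile_pos; auto).
  unfold mode. rewrite sin_deriv_0. split.
  - intros H. apply Rmult_integral in H. destruct H as [H|H]; [|lra].
    destruct (sin_eq_0_0 _ H) as [z Hz].
    assert (Hz0 : 0 <= IZR z).
    { pose proof PI_RGT_0. assert (0 < INR n * x) by nra. nra. }
    apply le_IZR in Hz0. exists (Z.to_nat z).
    rewrite (INR_IZR_INZ (Z.to_nat z)), Z2Nat.id by exact Hz0. exact Hz.
  - intros [j ->]. rewrite sin_nat_PI. ring.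
Qed.

Theorem theorem5p4 :
  exists ell : nat -> R,
    (forall k, 0 < ell k) /\ Un_cv ell 0 /\
    forall k : nat, (1 <= k)%nat ->
      exists lam u,
        is_lambda1 (ell k) lam /\ eigenfunction (ell k) lam u /\
        num_nodal_domains (ell k) u k.
Proof.
  destruct first_dispersion_zero as [s [t [Hs [Ht [HPI [H0 Hfirst]]]]]].
  pose proof PI_RGT_0 as HPI0.
  assert (HtP : t < PI) by nra.
  (* The value at index 0 is an arbitrary positive default, replacing a division by zero. *)
  exists (fun k => match k with O => s | S _ => s / INR k end).
  assert (Hpos : forall k : nat, (1 <= k)%nat -> 0 < s / INR k).
  { intros k Hk. apply Rdiv_lt_0_compat; [assumption|apply INR_pos_of_ge_1, Hk]. }
  split; [|split].
  - intros [|k]; [assumption|apply Hpos; lia].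
  - apply (Un_cv_div_INR s); [assumption|]. intros [|k] Hk; [lia|reflexivity].
  - intros k Hk.
    replace (match k with O => s | S _ => s / INR k end) with (s / INR k)
      by (destruct k; [lia|reflexivity]).
    assert (Hl := Hpos k Hk). assert (Hk0 := INR_pos_of_ge_1 k Hk).
    assert (Ekl : INR k * (s / INR k) = s) by (field; lra).
    set (l := s / INR k) in *. clearbody l.
    (* Chosen so that [(k l, w l)] is exactly the first zero [(s, t)]; hence
       [(k^2 + w^2) * l^2 = s^2 + t^2] attains the lower bound. *)
    set (w := t / l).
    assert (Ewl : w * l = t) by (unfold w; field; lra).
    assert (Hw : 0 < w) by (apply Rdiv_lt_0_compat; assumption).
    assert (Hd : dispersion (INR k * l) (w * l) = 0) by (rewrite Ekl, Ewl; exact H0).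
    assert (HwP : w * l < PI) by lra.
    assert (HE : eigenfunction l (INR k ^ 2 + w ^ 2) (mode (INR k) w l))
      by (apply mode_eigenfunction; assumption).
    exists (INR k ^ 2 + w ^ 2), (mode (INR k) w l).
    split; [split|split].
    + exists (mode (INR k) w l). exact HE.
    + intros mu Hmu.
      assert (Hb := eigenvalue_lower_bound s t l mu HPI Hfirst Hl Hmu).
      rewrite <- Ekl, <- Ewl in Hb.
      apply (Rmult_le_reg_r (l ^ 2)); [apply pow_lt; exact Hl|]. lra.
    + exact HE.
    + apply num_nodal_domains_strips; [assumption|assumption|].
      intros x y Hxy. apply mode_zero_iff; assumption.
Qed.
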